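(* (i) Let $R$ be a first countable strictly pro-right-artinian ring and let $M$ be a finitely presented right $R$-module. Then $\mathrm{End}(M_R)$ is pro-semiprimary and first countable (with respect to $\tau_2^M$). If $R$ is semiperfect (e.g. if $R$ is right noetherian), then $\mathrm{End}(M_R)$ is semiperfect. (ii) Let $S$ be a commutative first countable strictly pro-right-artinian ring and let $R$ be an $S$-algebra such that $R$ is finitely presented as an $S$-module. Then $R$ is pro-semiprimary (with respect to some topology). If $S$ is semiperfect (e.g. if $S$ is right noetherian), then $R$ is semiperfect.
   Context: All rings are unital. A topological ring $R$ is strictly pro-right-artinian if it is isomorphic, as a topological ring, to the inverse limit of an inverse system (indexed by a directed set) of discrete right artinian rings such that the standard map from $R$ to each of these rings is onto. A topological ring is pro-semiprimary if it is isomorphic, as a topological ring, to the inverse limit of an inverse system of discrete semiprimary rings. A topological ring is first countable if it has a countable basis of neighborhoods of $0$. A ring $R$ is semiprimary if $R/\mathrm{Jac}(R)$ is semisimple artinian and the Jacobson radical $\mathrm{Jac}(R)$ is nilpotent; semiperfect if $R/\mathrm{Jac}(R)$ is semisimple artinian and idempotents lift modulo $\mathrm{Jac}(R)$. The topology $\tau_2^M$ on $\mathrm{End}(M_R)$: choose an exact sequence $P_1\to P_0\to P_{-1}=M\to0$ with $P_0,P_1$ projective right $R$-modules. For each open two-sided ideal $J$ of $R$ let $\mathrm{B}(J)$ be the set of $f_{-1}\in\mathrm{Hom}_R(M,MJ)$ that extend to a chain map $(f_1,f_0,f_{-1})$ of this sequence to itself with $\mathrm{im}\,f_i\subseteq P_iJ$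 for $i=-1,0,1$. The sets $\mathrm{B}(J)$ are ideals forming a basis of neighborhoods of $0$ for a ring topology on $\mathrm{End}(M_R)$, independent of the chosen sequence, denoted $\tau_2^M$. *)

(* Defs.v *)
From HB Require Import structures.
From mathcomp Require Import all_boot all_order all_algebra.
From mathcomp Require Import boolp classical_sets functions cardinality.
From mathcomp Require Import topology tvs.

Set Implicit Arguments.
Unset Strict Implicit.
Unset Printing Implicit Defensive.

Import GRing.Theory.
Local Open Scope classical_set_scope.
Local Open Scope ring_scope.
Local Open Scope quotient_scope.

(* A right module over [R] is an [lmodType R^c]: for [a : R] and [v : V],
   [a *: v] stands for the right action of [a] on [v].  A notion stated for an
   [lmodType A] is about left modules if [A := R] and about right modules if
   [A := R^c]. *)

Definition surjective (X Y : Type) (f : X -> Y) := forall y, exists x, f x = y.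

Section Modules.
Variables (A : pzRingType) (V : lmodType A).
Implicit Types N : set V.

Definition submodule N := GRing.submod_closed [in N].

Definition proper_submodule N := submodule N /\ exists x, ~ N x.

Definition maximal_submodule N :=
  proper_submodule N /\ forall N', proper_submodule N' -> N `<=` N' -> N' = N.

Definition artinian_module :=
  forall N_ : nat -> set V, (forall n, submodule (N_ n)) ->
    (forall n, N_ n.+1 `<=` N_ n) ->
  exists n, forall m, (n <= m)%N -> N_ m = N_ n.

Definition noetherian_module :=
  forall N_ : nat -> set V, (forall n, submodule (N_ n)) ->
    (forall n, N_ n `<=` N_ n.+1) ->
  exists n, forall m, (n <= m)%N -> N_ m = N_ n.

Definition semisimple_module :=
  forall N, submodule N -> exists N', [/\ submodule N',
    N `&` N' = [set 0] & forall v, exists x y, [/\ N x, N' y & v = x + y]].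

Definition finitely_presented :=
  exists m n (f : {linear 'rV[A]_m -> 'rV[A]_n}) (g : {linear 'rV[A]_n -> V}),
    surjective g /\ forall x, g x = 0 <-> exists y, f y = x.

Definition projective :=
  forall (B C : lmodType A) (g : {linear B -> C}) (f : {linear V -> C}),
    surjective g -> exists h : {linear V -> B}, forall x, g (h x) = f x.

(* The submodule [V J], consisting of the finite sums of elements [v * a] with
   [v] in [V] and [a] in [J]. *)
Definition mulmod (J : set A) : set V :=
  [set v | exists2 s : seq (V * A),
     (forall x, x \in s -> J x.2) & v = \sum_(x <- s) x.2 *: x.1].

End Modules.

Arguments artinian_module {A} V.
Arguments noetherian_module {A} V.
Arguments semisimple_module {A} V.
Arguments finitely_presented {A} V.
Arguments projective {A} V.
Arguments mulmod {A} V J.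

Lemma submoduleP (A : pzRingType) (V : lmodType A) (N : set V) :
  submodule N <-> N 0 /\ forall a x y, N x -> N y -> N (a *: x + y).
Proof.
split=> -[N0 NS]; split.
- exact: (set_mem N0).
- by move=> a x y /mem_set Nx /mem_set Ny; exact: (set_mem (NS a x y Nx Ny)).
- exact: (mem_set N0).
- by move=> a x y /set_mem Nx /set_mem Ny; exact: (mem_set (NS a x y Nx Ny)).
Qed.

(* The right module [R_R]; here [a *: x = x * a]. *)
Definition right_regular (R : pzRingType) : lmodType R^c := (R^c)^o.

Definition right_artinian (R : pzRingType) := artinian_module (right_regular R).

Definition right_noetherian (R : pzRingType) :=
  noetherian_module (right_regular R).

Section TwoSidedIdeals.
Variable R : pzRingType.

Definition two_sided_ideal (I : set R) :=
  [/\ I 0, forall x y, I x -> I y -> I (x - y),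
      forall a x, I x -> I (a * x) & forall a x, I x -> I (x * a)].

Record ideal := Ideal {
  ideal_set : set R;
  idealP : two_sided_ideal ideal_set }.

Definition ideal_mem (I : ideal) : {pred R} := fun x => `[< ideal_set I x >].

Lemma ideal_mem_closed (I : ideal) : zmod_closed (ideal_mem I).
Proof.
case: (idealP I) => I0 IB _ _; split; first exact/asboolP.
by move=> x y /asboolP Ix /asboolP Iy; apply/asboolP/IB.
Qed.

HB.instance Definition _ (I : ideal) :=
  GRing.isZmodClosed.Build R (ideal_mem I) (ideal_mem_closed I).

End TwoSidedIdeals.

Section QuotientRing.
Variables (R : pzRingType) (I : ideal R).

(* The library's [{quot I}] is a ring for commutative [R] only. *)
Definition quotient_ring : Type := Quotient.quot (ideal_mem I).

HB.instance Definition _ := GRing.Zmodule.on quotient_ring.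

Definition quotient_proj (x : R) : quotient_ring :=
  \pi_(Quotient.quot (ideal_mem I)) x.

Lemma quotient_proj_eq x y :
  quotient_proj x = quotient_proj y <-> ideal_set I (x - y).
Proof.
rewrite /quotient_proj; split.
  by move/eqP; rewrite -Quotient.idealrBE => /asboolP.
by move=> Ixy; apply/eqP; rewrite -Quotient.idealrBE; apply/asboolP.
Qed.

Lemma quotient_projK (x : quotient_ring) : quotient_proj (repr x) = x.
Proof. exact: reprK. Qed.

Lemma quotient_proj_zmod : zmod_morphism quotient_proj.
Proof. by move=> x y; rewrite /quotient_proj !piE. Qed.

HB.instance Definition _ :=
  GRing.isZmodMorphism.Build R quotient_ring quotient_proj quotient_proj_zmod.

Definition quotient_one := quotient_proj 1.

Definition quotient_mul (x y : quotient_ring) :=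
  quotient_proj (repr x * repr y).

Lemma quotient_projM x y :
  quotient_proj (x * y) = quotient_mul (quotient_proj x) (quotient_proj y).
Proof.
apply/quotient_proj_eq; case: (idealP I) => I0 IB Il Ir.
have Irepr z : ideal_set I (z - repr (quotient_proj z)).
  by apply/quotient_proj_eq; rewrite quotient_projK.
set x' := repr _; set y' := repr _.
have -> : x * y - x' * y' = (x - x') * y - - (x' * (y - y')).
  by rewrite opprK mulrBl mulrBr addrA subrK.
apply: (IB); first exact/Ir/Irepr.
by rewrite -(sub0r (x' * _)); apply: (IB) => //; exact/Il/Irepr.
Qed.

Lemma quotient_mulA : associative quotient_mul.
Proof.
move=> x y z; rewrite -[x]quotient_projK -[y]quotient_projK.
by rewrite -[z]quotient_projK -!quotient_projM mulrA.
Qed.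

Lemma quotient_mul1 : left_id quotient_one quotient_mul.
Proof. by move=> x; rewrite -[x]quotient_projK -quotient_projM mul1r. Qed.

Lemma quotient_1mul : right_id quotient_one quotient_mul.
Proof. by move=> x; rewrite -[x]quotient_projK -quotient_projM mulr1. Qed.

Lemma quotient_mulDl : left_distributive quotient_mul +%R.
Proof.
move=> x y z; rewrite -[x]quotient_projK -[y]quotient_projK.
by rewrite -[z]quotient_projK -raddfD -!quotient_projM mulrDl raddfD.
Qed.

Lemma quotient_mulDr : right_distributive quotient_mul +%R.
Proof.
move=> x y z; rewrite -[x]quotient_projK -[y]quotient_projK.
by rewrite -[z]quotient_projK -raddfD -!quotient_projM mulrDr raddfD.
Qed.

HB.instance Definition _ := GRing.Zmodule_isPzRing.Build quotient_ring
  quotient_mulA quotient_mul1 quotient_1mul quotient_mulDl quotient_mulDr.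

HB.instance Definition _ := GRing.isMonoidMorphism.Build R quotient_ring
  quotient_proj (erefl, quotient_projM).

End QuotientRing.

Definition Jac_set (R : pzRingType) : set R :=
  \bigcap_(N in @maximal_submodule R^c (right_regular R)) N.

Lemma Jac_subproof (R : pzRingType) : two_sided_ideal (@Jac_set R).
Proof.
have subP (N : set R) : @submodule R^c (right_regular R) N ->
    [/\ N 0, forall x y, N x -> N y -> N (x + y) &
        forall x a, N x -> N (x * a)].
  move=> /submoduleP [N0 NS]; split=> //.
    by move=> x y Nx Ny; have := NS 1 x y Nx Ny; rewrite scale1r.
  by move=> x a Nx; have := NS a x 0 Nx N0; rewrite addr0.
split.
- by move=> N [[/subP[N0 _ _] _] _].
- move=> x y Jx Jy N maxN; have [[/subP[N0 ND NM] _] _] := maxN.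
  rewrite -mulrN1; apply: (ND); first exact: (Jx N maxN).
  exact: NM (Jy N maxN).
- move=> a x Jx N maxN; have [[/subP[N0 ND NM] _] Nmax] := maxN.
  apply: contrapT => Nax.
  pose K : set R := [set y | N (a * y)].
  suff maxK : @maximal_submodule R^c (right_regular R) K.
    by apply: Nax; exact: (Jx K maxK).
  have subK : @submodule R^c (right_regular R) K.
    apply/submoduleP; split; first by rewrite /K /= mulr0.
    move=> b y z Ky Kz; rewrite /K /= mulrDr; apply: (ND) => //.
    by have := NM _ b Ky; rewrite -mulrA.
  split; first by split=> //; exists x.
  move=> K' [subK' [w K'w]] KK'; apply/seteqP; split=> // y K'y.
  apply: contrapT => Ky; rewrite /= in Ky.
  have [K'0 K'D K'M] := subP _ subK'.
  pose L : set R := [set z | exists u b : R, N u /\ z = u + a * y * b].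
  have subL : @submodule R^c (right_regular R) L.
    apply/submoduleP; split; first by exists 0, 0; rewrite mulr0 addr0.
    move=> c _ _ [u [b [Nu ->]]] [u' [b' [Nu' ->]]].
    exists (u * (c : R) + u'), (b * (c : R) + b'); split.
      by apply: (ND) => //; exact: NM.
    rewrite -[c *: _]/((u + a * y * b) * (c : R)).
    by rewrite mulrDl mulrDr addrACA mulrA.
  have Lall z : L z.
    apply: contrapT => Lz; apply: Ky.
    have LN : L = N.
      apply: Nmax; first by split=> //; exists z.
      by move=> u Nu; exists u, 0; rewrite mulr0 addr0.
    suff : L (a * y) by rewrite LN.
    by exists 0, 1; rewrite mulr1 add0r.
  have [u [b [Nu aE]]] := Lall a.
  apply: K'w; rewrite -[w](@mul1r R); apply: (K'M).
  rewrite -[1](subrK ((y : R) * b)); apply: (K'D); last exact: K'M.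
  by apply: KK'; rewrite /K /= mulrBr mulr1 mulrA {1}aE addrK.
- move=> a x Jx N maxN; have [[/subP[N0 ND NM] _] _] := maxN.
  exact: NM (Jx N maxN).
Qed.

Definition Jac (R : pzRingType) : ideal R := Ideal (@Jac_subproof R).

(* The second conjunct is implied by the first, which is already equivalent to
   the other usual definitions. *)
Definition semisimple_artinian (R : pzRingType) :=
  semisimple_module (right_regular R) /\ right_artinian R.

Definition nilpotent_ideal (R : pzRingType) (I : ideal R) :=
  exists n, forall x : 'I_n -> R, (forall i, ideal_set I (x i)) ->
    \prod_(i < n) x i = 0.

Definition idempotents_lift (R : pzRingType) (I : ideal R) :=
  forall x, ideal_set I (x * x - x) ->
    exists2 e, e * e = e & ideal_set I (e - x).

Definition semiprimary (R : pzRingType) :=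
  semisimple_artinian (quotient_ring (Jac R)) /\ nilpotent_ideal (Jac R).

Definition semiperfect (R : pzRingType) :=
  semisimple_artinian (quotient_ring (Jac R)) /\ idempotents_lift (Jac R).

(* Topological rings are not assumed to be Hausdorff. *)

HB.mixin Record TopologicalZmodule_isTopologicalPzRing R
    & TopologicalZmodule R & GRing.PzRing R := {
  mul_continuous : continuous (fun x : R * R => x.1 * x.2) ;
}.

#[short(type="topPzRingType")]
HB.structure Definition TopPzRing :=
  {R of TopologicalZmodule R & GRing.PzRing R
        & TopologicalZmodule_isTopologicalPzRing R}.

#[short(type="topComPzRingType")]
HB.structure Definition TopComPzRing :=
  {R of TopPzRing R & GRing.ComPzRing R}.

Definition first_countable (R : topPzRingType) :=
  exists2 B : set (set R), countable B &
    B `<=` nbhs (0 : R) /\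
    forall U, nbhs (0 : R) U -> exists2 W, B W & W `<=` U.

Record invSystem := InvSystem {
  inv_disp : Order.disp_t;
  inv_idx : preorderType inv_disp;
  inv_idx_nonempty : inhabited inv_idx;
  inv_idx_directed : forall i j : inv_idx, exists2 k, (i <= k)%O & (j <= k)%O;
  inv_ring :> inv_idx -> pzRingType;
  inv_map : forall i j, (i <= j)%O -> {rmorphism inv_ring j -> inv_ring i};
  inv_map_id : forall i (ii : (i <= i)%O) x, inv_map ii x = x;
  inv_map_comp : forall i j k (ij : (i <= j)%O) (jk : (j <= k)%O)
    (ik : (i <= k)%O) x, inv_map ij (inv_map jk x) = inv_map ik x }.

Section InverseLimit.
Variable X : invSystem.

Definition inv_compatible (x : forall i, X i) :=
  `[< forall i j (ij : (i <= j)%O), inv_map ij (x j) = x i >].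

Definition invlim := {x : forall i, X i | inv_compatible x}.

HB.instance Definition _ := Choice.on invlim.

Definition invlim_proj (i : inv_idx X) (x : invlim) : X i := val x i.

Lemma invlimP (x y : invlim) :
  (forall i, invlim_proj i x = invlim_proj i y) -> x = y.
Proof. by move=> xy; apply/val_inj/functional_extensionality_dep. Qed.

Lemma invlim_projP (x : invlim) i j (ij : (i <= j)%O) :
  inv_map ij (invlim_proj j x) = invlim_proj i x.
Proof. by have /asboolP xP := valP x; exact: xP. Qed.

Definition invlim_mk (x : forall i, X i)
  (xP : forall i j (ij : (i <= j)%O), inv_map ij (x j) = x i) : invlim :=
  exist (fun x => inv_compatible x) x (asboolT xP).

Definition invlim0 : invlim :=
  @invlim_mk (fun=> 0) (fun i j ij => rmorph0 (inv_map ij)).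

Definition invlim1 : invlim :=
  @invlim_mk (fun=> 1) (fun i j ij => rmorph1 (inv_map ij)).

Definition invlimN (x : invlim) : invlim.
Proof.
apply: (@invlim_mk (fun i => - invlim_proj i x)) => i j ij.
by rewrite rmorphN invlim_projP.
Defined.

Definition invlimD (x y : invlim) : invlim.
Proof.
apply: (@invlim_mk (fun i => invlim_proj i x + invlim_proj i y)) => i j ij.
by rewrite rmorphD !invlim_projP.
Defined.

Definition invlimM (x y : invlim) : invlim.
Proof.
apply: (@invlim_mk (fun i => invlim_proj i x * invlim_proj i y)) => i j ij.
by rewrite rmorphM !invlim_projP.
Defined.

Fact invlimDA : associative invlimD.
Proof. by move=> x y z; apply: invlimP => i; exact: addrA. Qed.
Fact invlimDC : commutative invlimD.
Proof. by move=> x y; apply: invlimP => i; exact: addrC. Qed.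
Fact invlim0D : left_id invlim0 invlimD.
Proof. by move=> x; apply: invlimP => i; exact: add0r. Qed.
Fact invlimND : left_inverse invlim0 invlimN invlimD.
Proof. by move=> x; apply: invlimP => i; exact: addNr. Qed.
Fact invlimMA : associative invlimM.
Proof. by move=> x y z; apply: invlimP => i; exact: mulrA. Qed.
Fact invlim1M : left_id invlim1 invlimM.
Proof. by move=> x; apply: invlimP => i; exact: mul1r. Qed.
Fact invlimM1 : right_id invlim1 invlimM.
Proof. by move=> x; apply: invlimP => i; exact: mulr1. Qed.
Fact invlimMDl : left_distributive invlimM invlimD.
Proof. by move=> x y z; apply: invlimP => i; exact: mulrDl. Qed.
Fact invlimMDr : right_distributive invlimM invlimD.
Proof. by move=> x y z; apply: invlimP => i; exact: mulrDr. Qed.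

HB.instance Definition _ := GRing.isZmodule.Build invlim
  invlimDA invlimDC invlim0D invlimND.
HB.instance Definition _ := GRing.Zmodule_isPzRing.Build invlim
  invlimMA invlim1M invlimM1 invlimMDl invlimMDr.

(* The inverse limit topology is induced by the product of the discrete
   topologies. *)
Definition invlim_val (x : invlim) :
  prod_topology (fun i => discrete_topology (X i)) := val x.

HB.instance Definition _ :=
  Topological.copy invlim (initial_topology invlim_val).

Lemma continuous_to_invlim (T : topologicalType) (f : T -> invlim) :
  (forall i, continuous (fun t => invlim_proj i (f t) : discrete_topology (X i)))
  -> continuous f.
Proof.
move=> cf; apply: continuous_comp_initial => t; apply/cvg_sup => i.
apply: (@continuous_comp_initial _ _ _
  (fun x : (forall i, discrete_topology (X i)) => x i)
  (invlim_val \o f)).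
exact: cf.
Qed.

Lemma invlim_proj_continuous i :
  continuous (fun x => invlim_proj i x : discrete_topology (X i)).
Proof.
move=> x; apply: (@continuous_comp _ _ _ invlim_val
  (fun g : prod_topology (fun i => discrete_topology (X i)) => g i)).
  exact: initial_continuous.
exact: (@proj_continuous _ (fun i => discrete_topology (X i)) i).
Qed.

Lemma invlim_op2_continuous
    (op : forall i, X i -> X i -> X i) (f : invlim * invlim -> invlim) :
  (forall i x, invlim_proj i (f x)
     = op i (invlim_proj i x.1) (invlim_proj i x.2)) ->
  continuous f.
Proof.
move=> fE; apply: continuous_to_invlim => i [x y].
have nx z : nbhs z [set w | invlim_proj i w = invlim_proj i z].
  apply: (@invlim_proj_continuous i z [set invlim_proj i z]).
  exact: discrete_set1.
move=> U /nbhs_singleton Uxy.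
exists ([set w | invlim_proj i w = invlim_proj i x],
        [set w | invlim_proj i w = invlim_proj i y]); first by split.
by move=> [a b] [/= ax bY]; move: Uxy; rewrite !fE /= ax bY.
Qed.

Let sub_continuous : continuous (fun x : invlim * invlim => x.1 - x.2).
Proof. exact: (@invlim_op2_continuous (fun i a b => a - b)). Qed.

HB.instance Definition _ :=
  PreTopologicalNmodule_isTopologicalZmodule.Build invlim sub_continuous.

Let mul_continuous : continuous (fun x : invlim * invlim => x.1 * x.2).
Proof. exact: (@invlim_op2_continuous (fun i a b => a * b)). Qed.

HB.instance Definition _ :=
  TopologicalZmodule_isTopologicalPzRing.Build invlim mul_continuous.

End InverseLimit.

Definition top_ring_iso (R T : topPzRingType) (phi : {rmorphism R -> T}) :=
  exists psi : T -> R,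
    [/\ cancel phi psi, cancel psi phi, continuous phi & continuous psi].

Definition pro_semiprimary (R : topPzRingType) :=
  exists (X : invSystem) (phi : {rmorphism R -> invlim X}),
    top_ring_iso phi /\ forall i, semiprimary (X i).

Definition strictly_pro_right_artinian (R : topPzRingType) :=
  exists (X : invSystem) (phi : {rmorphism R -> invlim X}),
    [/\ top_ring_iso phi, forall i, right_artinian (X i) &
        forall i, surjective (fun r => invlim_proj i (phi r))].

Record idealBase (E : pzRingType) := IdealBase {
  ideal_base : set (set E);
  ideal_base_nonempty : ideal_base !=set0;
  ideal_base_directed : forall A B, ideal_base A -> ideal_base B ->
    exists2 C, ideal_base C & C `<=` A `&` B;
  ideal_baseP : forall A, ideal_base A -> two_sided_ideal A }.

(* The ring [E] with the ring topology in which the two-sided ideals of [b] form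
   a basis of neighborhoods of 0. *)
Definition linear_topology (E : pzRingType) (b : idealBase E) : Type := E.

Section LinearTopology.
Variables (E : pzRingType) (b : idealBase E).
Local Notation T := (linear_topology b).

HB.instance Definition _ := GRing.PzRing.on T.

Definition linear_nbhs (x : T) : set_system T :=
  [set U | exists2 A, ideal_base b A & forall a : E, A a -> U ((x : E) + a)].

HB.instance Definition _ := hasNbhs.Build T linear_nbhs.

Let linear_nbhs_filter (x : T) : ProperFilter (nbhs x).
Proof.
split.
  move=> [A bA /(_ 0)]; apply.
  by case: (ideal_baseP bA).
split.
- by have [A bA] := ideal_base_nonempty b; exists A.
- move=> U W [A bA AU] [B bB BW].
  have [C bC CAB] := ideal_base_directed bA bB.
  by exists C => // a /CAB [Aa Ba]; split; [exact: AU|exact: BW].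
- by move=> U W UW [A bA AU]; exists A => // a Aa; apply/UW/AU.
Qed.

Let linear_nbhs_singleton (x : T) (U : set T) : nbhs x U -> U x.
Proof.
move=> [A bA /(_ 0)]; rewrite addr0; apply.
by case: (ideal_baseP bA).
Qed.

Lemma idealD (A : set E) x y : two_sided_ideal A -> A x -> A y -> A (x + y).
Proof.
move=> [A0 AB _ _] Ax Ay; rewrite -[y]opprK; apply: (AB) => //.
by rewrite -sub0r; apply: (AB).
Qed.

Let linear_nbhs_nbhs (x : T) (U : set T) : nbhs x U -> nbhs x (nbhs^~ U).
Proof.
move=> [A bA AU]; exists A => // a Aa; exists A => // c Ac.
rewrite -addrA; apply: AU; exact: idealD (ideal_baseP bA) Aa Ac.
Qed.

HB.instance Definition _ := Nbhs_isNbhsTopological.Build T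
  linear_nbhs_filter linear_nbhs_singleton linear_nbhs_nbhs.

Let nbhs_coset (x : T) A : ideal_base b A -> nbhs x [set y | A ((y : E) - x)].
Proof. by move=> bA; exists A => // a Aa /=; rewrite addrC addKr. Qed.

Let sub_continuous : continuous (fun x : T * T => x.1 - x.2).
Proof.
move=> [x y] U [A bA AU]; have [A0 AB Al Ar] := ideal_baseP bA.
exists ([set z | A ((z : E) - x)], [set z | A ((z : E) - y)]).
  by split; exact: nbhs_coset.
move=> [u v] [/= Aux Avy]; rewrite /nbhs /=.
suff -> : u - v = (x - y : E) + ((u - x) - (v - y)) by exact/AU/AB.
by rewrite opprB addrACA addKr [x + _]addrC subrK.
Qed.

HB.instance Definition _ :=
  PreTopologicalNmodule_isTopologicalZmodule.Build T sub_continuous.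

Let mul_continuous : continuous (fun x : T * T => x.1 * x.2).
Proof.
move=> [x y] U [A bA AU]; have [A0 AB Al Ar] := ideal_baseP bA.
exists ([set z | A ((z : E) - x)], [set z | A ((z : E) - y)]).
  by split; exact: nbhs_coset.
move=> [u v] [/= Aux Avy]; rewrite /nbhs /=.
suff -> : u * v = (x * y : E) + ((u - x) * v + x * (v - y)).
  apply: AU; apply: (idealD (ideal_baseP bA)); [exact: Ar|exact: Al].
by rewrite mulrBl mulrBr [x * y + _]addrC !addrA !subrK.
Qed.

HB.instance Definition _ :=
  TopologicalZmodule_isTopologicalPzRing.Build T mul_continuous.

End LinearTopology.

(* Multiplication is composition, [(f * g) x = f (g x)]. *)
Definition endo (A : pzRingType) (M : lmodType A) : Type := {linear M -> M}.

Section EndomorphismRing.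
Variables (A : pzRingType) (M : lmodType A).

HB.instance Definition _ := gen_eqMixin (endo M).
HB.instance Definition _ := gen_choiceMixin (endo M).

Lemma linear_ext (U V : lmodType A) (f g : {linear U -> V}) : f =1 g -> f = g.
Proof.
case: f g => [f fP] [g gP] /= /funext fg; case: _ / fg in gP *.
congr GRing.Linear.Pack.
case: fP gP => [[f0] [fZ]] [[g0] [gZ]].
by rewrite (Prop_irrelevance f0 g0) (Prop_irrelevance fZ gZ).
Qed.

Definition endo0 : endo M := \0 : {linear M -> M}.
Definition endo1 : endo M := idfun : {linear M -> M}.
Definition endoN (f : endo M) : endo M := (\- f) : {linear M -> M}.
Definition endoD (f g : endo M) : endo M := (f \+ g) : {linear M -> M}.
Definition endoM (f g : endo M) : endo M := (f \o g) : {linear M -> M}.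

Fact endoDA : associative endoD.
Proof. by move=> f g h; apply: linear_ext => x; exact: addrA. Qed.
Fact endoDC : commutative endoD.
Proof. by move=> f g; apply: linear_ext => x; exact: addrC. Qed.
Fact endo0D : left_id endo0 endoD.
Proof. by move=> f; apply: linear_ext => x; exact: add0r. Qed.
Fact endoND : left_inverse endo0 endoN endoD.
Proof. by move=> f; apply: linear_ext => x; exact: addNr. Qed.
Fact endoMA : associative endoM.
Proof. by move=> f g h; apply: linear_ext. Qed.
Fact endo1M : left_id endo1 endoM.
Proof. by move=> f; apply: linear_ext. Qed.
Fact endoM1 : right_id endo1 endoM.
Proof. by move=> f; apply: linear_ext. Qed.
Fact endoMDl : left_distributive endoM endoD.
Proof. by move=> f g h; apply: linear_ext. Qed.
Fact endoMDr : right_distributive endoM endoD.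
Proof. by move=> f g h; apply: linear_ext => x; exact: raddfD. Qed.

HB.instance Definition _ := GRing.isZmodule.Build (endo M)
  endoDA endoDC endo0D endoND.
HB.instance Definition _ := GRing.Zmodule_isPzRing.Build (endo M)
  endoMA endo1M endoM1 endoMDl endoMDr.

End EndomorphismRing.

(* An exact sequence [P1 -> P0 -> M -> 0] with [P0] and [P1] projective. *)
Record projPresentation (A : pzRingType) (M : lmodType A) := ProjPresentation {
  pres1 : lmodType A;
  pres0 : lmodType A;
  pres_d1 : {linear pres1 -> pres0};
  pres_d0 : {linear pres0 -> M};
  pres1_projective : projective pres1;
  pres0_projective : projective pres0;
  pres_d0_surjective : surjective pres_d0;
  pres_exact : forall x, pres_d0 x = 0 <-> exists y, pres_d1 y = x }.

Lemma rV_projective (A : pzRingType) n : projective ('rV[A]_n : lmodType A).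
Proof.
move=> B C g f gs.
pose h i := projT1 (cid (gs (f (delta_mx 0 i)))).
have hE i : g (h i) = f (delta_mx 0 i) by rewrite /h; case: cid.
pose k (x : 'rV[A]_n) := \sum_i x 0 i *: h i.
have kl : linear k.
  move=> a x y; rewrite /k scaler_sumr -big_split /=; apply: eq_bigr => i _.
  by rewrite !mxE scalerDl scalerA.
pose kM := GRing.isLinear.Build _ _ _ _ k kl.
pose kL : {linear _ -> _} := HB.pack k kM.
exists kL => x; rewrite [x in RHS]row_sum_delta !linear_sum.
by apply: eq_bigr => i _; rewrite !linearZ /= hE.
Qed.

Lemma finitely_presented_projPresentation (A : pzRingType) (M : lmodType A) :
  finitely_presented M -> inhabited (projPresentation M).
Proof.
move=> [m [n [f [g [gs ex]]]]].
exact: inhabits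
  (ProjPresentation (@rV_projective _ m) (@rV_projective _ n) gs ex).
Qed.

Section MulmodTheory.
Variables (A : pzRingType) (V : lmodType A) (J : set A).

Lemma mulmod0 : mulmod V J 0.
Proof. by exists [::]; rewrite ?big_nil. Qed.

Lemma mulmodB x y : two_sided_ideal J ->
  mulmod V J x -> mulmod V J y -> mulmod V J (x - y).
Proof.
move=> [J0 JB _ _] [s sJ ->] [t tJ ->].
exists (s ++ [seq (z.1, - z.2) | z <- t]).
  move=> z; rewrite mem_cat => /orP[/sJ//|/mapP[w /tJ Jw ->]] /=.
  by rewrite -sub0r; apply: (JB).
rewrite big_cat big_map /= -sumrN; congr (_ + _).
by apply: eq_bigr => z _; rewrite scaleNr.
Qed.

Lemma mulmod_linear (W : lmodType A) (f : {linear V -> W}) x :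
  mulmod V J x -> mulmod W J (f x).
Proof.
move=> [s sJ ->]; exists [seq (f z.1, z.2) | z <- s].
  by move=> z /mapP[w /sJ Jw ->].
by rewrite big_map linear_sum; apply: eq_bigr => z _; rewrite linearZ.
Qed.

Lemma mulmodS (K : set A) : J `<=` K -> mulmod V J `<=` mulmod V K.
Proof. by move=> JK x [s sJ ->]; exists s => // z /sJ /JK. Qed.

End MulmodTheory.

Section Kernel.
Variables (A : pzRingType) (U V : lmodType A) (f : {linear U -> V}).

Definition ker_mem : {pred U} := fun x => f x == 0.

Lemma ker_mem_closed : GRing.submod_closed ker_mem.
Proof.
split; first by rewrite unfold_in /ker_mem linear0.
move=> a x y; rewrite !unfold_in /ker_mem => /eqP fx /eqP fy.
by rewrite linearP fx fy scaler0 addr0.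
Qed.

HB.instance Definition _ := GRing.isSubmodClosed.Build A U ker_mem ker_mem_closed.

Record ker_type := KerType { ker_val : U; _ : ker_val \in ker_mem }.

HB.instance Definition _ := [isSub for ker_val].
HB.instance Definition _ := [Choice of ker_type by <:].
HB.instance Definition _ := [SubChoice_isSubLmodule of ker_type by <:].

End Kernel.

Section Tau2.
Variables (R : topPzRingType) (M : lmodType R^c) (P : projPresentation M).

(* The set [B(J)]. *)
Definition tau2_set (J : set R) : set (endo M) :=
  [set f : endo M | exists (f0 : endo (pres0 P)) (f1 : endo (pres1 P)),
    [/\ forall x, pres_d0 P (f0 x) = f (pres_d0 P x),
        forall x, pres_d1 P (f1 x) = f0 (pres_d1 P x),
        range f `<=` mulmod M J,
        range f0 `<=` mulmod (pres0 P) J &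
        range f1 `<=` mulmod (pres1 P) J]].

Definition tau2_nbhs0 : set (set (endo M)) :=
  [set B | exists J : set R,
     [/\ open J, two_sided_ideal J & B = tau2_set J]].

Lemma endo_lift (g : endo M) :
  exists (g0 : endo (pres0 P)) (g1 : endo (pres1 P)),
    (forall x, pres_d0 P (g0 x) = g (pres_d0 P x)) /\
    (forall x, pres_d1 P (g1 x) = g0 (pres_d1 P x)).
Proof.
have [g0 g0E] := @pres0_projective _ _ P _ _ (pres_d0 P)
  ((g : {linear M -> M}) \o pres_d0 P) (@pres_d0_surjective _ _ P).
have d01 x : pres_d0 P (pres_d1 P x) = 0.
  by apply/(@pres_exact _ _ P); exists x.
have toker (Q : lmodType R^c) (h : {linear Q -> pres0 P}) :
    (forall x, pres_d0 P (h x) = 0) ->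
    exists k : {linear Q -> ker_type (pres_d0 P)}, forall x, val (k x) = h x.
  move=> h0; have hK x : h x \in ker_mem (pres_d0 P) by apply/eqP.
  pose k x : ker_type (pres_d0 P) := KerType (hK x).
  have klin : linear k.
    by move=> a x y; apply: val_inj; rewrite /= linearP.
  pose kM := GRing.isLinear.Build _ _ _ _ k klin.
  pose kL : {linear Q -> ker_type (pres_d0 P)} := HB.pack k kM.
  by exists kL.
have [d1' d1'E] := toker _ (pres_d1 P) d01.
have [h hE] := toker _ (g0 \o pres_d1 P)
  (fun x => etrans (g0E _) (etrans (congr1 g (d01 x)) (linear0 g))).
have d1'_surj : surjective d1'.
  move=> y; have [x xE] := (@pres_exact _ _ P (val y)).1 (eqP (valP y)).
  by exists x; apply: val_inj; rewrite d1'E.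
have [g1 g1E] := @pres1_projective _ _ P _ _ d1' h d1'_surj.
exists g0, g1; split=> // x.
by rewrite -d1'E g1E hE.
Qed.

Let tau2_nonempty : tau2_nbhs0 !=set0.
Proof. by exists (tau2_set setT), setT; split; [exact: openT|split|]. Qed.

Lemma tau2_setS (J K : set R) : J `<=` K -> tau2_set J `<=` tau2_set K.
Proof.
move=> JK f [f0 [f1 [c0 c1 i i0 i1]]].
by exists f0, f1; split=> // x;
  [move/i|move/i0|move/i1]; exact: (@mulmodS R^c).
Qed.

Let tau2_directed A B : tau2_nbhs0 A -> tau2_nbhs0 B ->
  exists2 C, tau2_nbhs0 C & C `<=` A `&` B.
Proof.
move=> [J [oJ iJ ->]] [K [oK iK ->]]; exists (tau2_set (J `&` K)).
  exists (J `&` K); split=> //; first exact: openI.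
  case: iJ iK => [J0 JB Jl Jr] [K0 KB Kl Kr]; split=> //.
  - by move=> x y [Jx Kx] [Jy Ky]; split; [exact: JB|exact: KB].
  - by move=> a x [Jx Kx]; split; [exact: Jl|exact: Kl].
  - by move=> a x [Jx Kx]; split; [exact: Jr|exact: Kr].
by move=> f Bf; split; apply: tau2_setS Bf => x [].
Qed.

Let tau2_ideal A : tau2_nbhs0 A -> two_sided_ideal A.
Proof.
move=> [J [oJ iJ ->]].
have iJc : two_sided_ideal (J : set R^c) by case: iJ.
split.
- exists 0, 0; split=> [x|x|_ [x _ <-]|_ [x _ <-]|_ [x _ <-]];
    rewrite ?linear0 //; exact: mulmod0.
- move=> f g [f0 [f1 [cf0 cf1 rf rf0 rf1]]] [g0 [g1 [cg0 cg1 rg rg0 rg1]]].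
  exists (f0 - g0), (f1 - g1); split.
  + by move=> x; rewrite [LHS]linearB cf0 cg0.
  + by move=> x; rewrite [LHS]linearB cf1 cg1.
  + by move=> _ [x _ <-]; apply: mulmodB; [|exact: rf|exact: rg].
  + by move=> _ [x _ <-]; apply: mulmodB; [|exact: rf0|exact: rg0].
  + by move=> _ [x _ <-]; apply: mulmodB; [|exact: rf1|exact: rg1].
- move=> g f [f0 [f1 [cf0 cf1 rf rf0 rf1]]].
  have [g0 [g1 [cg0 cg1]]] := endo_lift g.
  exists (g0 * f0), (g1 * f1); split.
  + by move=> x; rewrite [LHS]cg0 cf0.
  + by move=> x; rewrite [LHS]cg1 cf1.
  + by move=> _ [x _ <-]; apply: (mulmod_linear g); exact: rf.
  + by move=> _ [x _ <-]; apply: (mulmod_linear g0); exact: rf0.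
  + by move=> _ [x _ <-]; apply: (mulmod_linear g1); exact: rf1.
- move=> g f [f0 [f1 [cf0 cf1 rf rf0 rf1]]].
  have [g0 [g1 [cg0 cg1]]] := endo_lift g.
  exists (f0 * g0), (f1 * g1); split.
  + by move=> x; rewrite [LHS]cf0 cg0.
  + by move=> x; rewrite [LHS]cf1 cg1.
  + by move=> _ [x _ <-]; exact: rf.
  + by move=> _ [x _ <-]; exact: rf0.
  + by move=> _ [x _ <-]; exact: rf1.
Qed.

Definition tau2_base : idealBase (endo M) :=
  IdealBase tau2_nonempty tau2_directed tau2_ideal.

(* [End(M_R)] with the topology [tau_2^M] computed from [P]. *)
Definition endo_tau2 : topPzRingType := linear_topology tau2_base.

End Tau2.

(* [algType] excludes the zero ring, so an [S]-algebra is given by its central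
   structure morphism. *)

Definition central_morphism (S : comPzRingType) (R : pzRingType)
    (iota : {rmorphism S -> R}) :=
  forall s r, iota s * r = r * iota s.

Definition algebra_module (S : comPzRingType) (R : pzRingType)
  (iota : {rmorphism S -> R}) : Type := R.

Section AlgebraModule.
Variables (S : comPzRingType) (R : pzRingType) (iota : {rmorphism S -> R}).
Local Notation V := (algebra_module iota).

HB.instance Definition _ := GRing.Zmodule.on V.

Let scale (s : S) (r : V) : V := iota s * (r : R).

Let scaleA a b v : scale a (scale b v) = scale (a * b) v.
Proof. by rewrite /scale rmorphM mulrA. Qed.

Let scale1 : left_id 1 scale.
Proof. by move=> v; rewrite /scale rmorph1 mul1r. Qed.

Let scaleDr : right_distributive scale +%R.
Proof. by move=> a u v; exact: mulrDr. Qed.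

Let scaleDl v : {morph scale^~ v : a b / a + b}.
Proof. by move=> a b; rewrite /scale rmorphD mulrDl. Qed.

HB.instance Definition _ := GRing.Zmodule_isLmodule.Build S V
  scaleA scale1 scaleDr scaleDl.

End AlgebraModule.

(* Main.v *)
(* If [V] is a complete separated module with a decreasing sequence of submodules
   [F k] such that the quotients [V / F k] have finite length, then Fitting's lemma
   modulo every [F k] gives each endomorphism [x] a Drazin inverse [y]; by
   uniqueness [y] commutes with everything that commutes with [x].  So every
   centralizer [T] in [End V] is closed under Drazin inverses: [x y] is an
   idempotent in [x T], and if it vanishes, [1 - x] is invertible.  A ring with
   this property and without infinite chains of idempotents is semiperfect.  The
   chain condition holds in the image of [T] in [End (V / F k)], whose radical is
   nil, hence nilpotent, and in [T] itself when the base ring is semiperfect or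
   right noetherian.

   For [M] with a presentation [R^m -> R^n -> M -> 0], the chain endomorphisms of
   the presentation form a centralizer in [End (R^(n+m))] that maps onto [End M],
   inducing [tau_2].  Finite length holds by the Hopkins-Levitzki theorem, and [M]
   itself is separated and complete by a Mittag-Leffler argument.  In (ii), [R] is
   the centralizer of the right multiplications in [End_S R]. *)

Require Import Defs.
From HB Require Import structures.
From mathcomp Require Import all_boot all_order all_algebra.
From mathcomp Require Import boolp classical_sets cardinality topology.

Set Implicit Arguments.
Unset Strict Implicit.
Unset Printing Implicit Defensive.

Import GRing.Theory.
Local Open Scope classical_set_scope.
Local Open Scope ring_scope.

(** * Submodules and semiperfect rings *)

(** The Fitting index of [x] on [V / F k] may grow with [k], so [x] need not split [V] into an
    invertible and a nilpotent part. Modulo each [F k] the Drazin inverse is nevertheless unique, so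
    it glues, and uniqueness rather than a formula puts it into the centralizer. The ring [End M]
    does not suffice for the topology: [tau_2] constrains the lifts of an endomorphism to the
    presentation and not only its range. On the sum of the two free modules these constraints become
    a single one. Finiteness of chains of idempotents does not pass from the quotients to the limit,
    as an infinite product of fields shows. When [R / Jac R] is artinian it holds in the limit too,
    because it holds modulo [M Jac(R)] and no nonzero idempotent endomorphism has its range in
    [M Jac(R)]. *)

Section Submodules.
Variables (A : pzRingType) (V : lmodType A).
Implicit Types N : set V.

Lemma submod0 N : submodule N -> N 0.
Proof. by case/submoduleP. Qed.

Lemma submodD N x y : submodule N -> N x -> N y -> N (x + y).
Proof. by case/submoduleP => _ H Nx Ny; have := H 1 x y Nx Ny; rewrite scale1r. Qed.

Lemma submodZ N a x : submodule N -> N x -> N (a *: x).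
Proof.
by case/submoduleP => N0 H Nx; have := H a x 0 Nx N0; rewrite addr0.
Qed.

Lemma submodN N x : submodule N -> N x -> N (- x).
Proof. by move=> sN Nx; rewrite -scaleN1r; exact: submodZ. Qed.

Lemma submodB N x y : submodule N -> N x -> N y -> N (x - y).
Proof. by move=> sN Nx Ny; apply: submodD => //; exact: submodN. Qed.

Lemma submodP N : N 0 -> (forall x y, N x -> N y -> N (x + y)) ->
  (forall a x, N x -> N (a *: x)) -> submodule N.
Proof. by move=> N0 ND NZ; apply/submoduleP; split=> // a x y /NZ; eauto. Qed.

Lemma submodTR N x y : submodule N -> N (x - y) -> N y -> N x.
Proof. by move=> sN Nxy Ny; rewrite -[x](subrK y); exact: submodD. Qed.

Definition sumset N N' : set V := [set v | exists x y, [/\ N x, N' y & v = x + y]].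

Lemma submodule_sumset N N' : submodule N -> submodule N' ->
  submodule (sumset N N').
Proof.
move=> sN sN'; apply: submodP.
- by exists 0, 0; split; [exact: submod0|exact: submod0|rewrite addr0].
- move=> _ _ [x [x' [Nx Nx' ->]]] [y [y' [Ny Ny' ->]]].
  by exists (x + y), (x' + y'); split; [exact: submodD|exact: submodD|rewrite addrACA].
- move=> a _ [x [x' [Nx Nx' ->]]].
  by exists (a *: x), (a *: x'); split; [exact: submodZ|exact: submodZ|rewrite scalerDr].
Qed.

Lemma submoduleI N N' : submodule N -> submodule N' -> submodule (N `&` N').
Proof.
move=> sN sN'; apply: submodP; first by split; exact: submod0.
- by move=> x y [Nx Nx'] [Ny Ny']; split; exact: submodD.
- by move=> a x [Nx Nx']; split; exact: submodZ.
Qed.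

End Submodules.

Lemma submodule_preimage (A : pzRingType) (U V : lmodType A)
  (f : {linear U -> V}) (N : set V) : submodule N -> submodule (f @^-1` N).
Proof.
move=> sN; apply: submodP; rewrite /preimage /=.
- by rewrite linear0; exact: submod0.
- by move=> x y Nx Ny; rewrite linearD; exact: submodD.
- by move=> a x Nx; rewrite linearZ; exact: submodZ.
Qed.

Lemma submodule_image (A : pzRingType) (U V : lmodType A)
  (f : {linear U -> V}) (N : set U) : submodule N -> submodule (f @` N).
Proof.
move=> sN; apply: submodP.
- by exists 0; [exact: submod0|rewrite linear0].
- by move=> _ _ [x Nx <-] [y Ny <-]; exists (x + y); [exact: submodD|rewrite linearD].
- by move=> a _ [x Nx <-]; exists (a *: x); [exact: submodZ|rewrite linearZ].
Qed.

Section RightIdeals.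
Variable T : pzRingType.
Implicit Types (I : set T) (x y a : T).

Definition right_ideal I := @submodule T^c (right_regular T) I.

Lemma right_idealP I : I 0 -> (forall x y, I x -> I y -> I (x + y)) ->
  (forall x a, I x -> I (x * a)) -> right_ideal I.
Proof. by move=> I0 ID IM; apply: submodP => // a x Ix; exact: IM. Qed.

Lemma ridealM I x a : right_ideal I -> I x -> I (x * a).
Proof. by move=> rI Ix; exact: (@submodZ _ (right_regular T) I a x rI Ix). Qed.

Lemma ridealB I x y : right_ideal I -> I x -> I y -> I (x - y).
Proof. exact: (@submodB _ (right_regular T) I x y). Qed.

Lemma ridealD I x y : right_ideal I -> I x -> I y -> I (x + y).
Proof. exact: (@submodD _ (right_regular T) I x y). Qed.

Lemma rideal0 I : right_ideal I -> I 0.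
Proof. exact: (@submod0 _ (right_regular T) I). Qed.

Lemma right_ideal_principal x : right_ideal [set z | exists a, z = x * a].
Proof.
apply: right_idealP; first by exists 0; rewrite mulr0.
- by move=> _ _ [a ->] [b ->]; exists (a + b); rewrite mulrDr.
- by move=> _ b [a ->]; exists (a * b); rewrite mulrA.
Qed.

Lemma maximal_right_ideal_exists I : right_ideal I -> ~ I 1 ->
  exists2 N, @maximal_submodule T^c (right_regular T) N & I `<=` N.
Proof.
move=> rI I1.
pose P (N : set T) := N = set0 \/ [/\ right_ideal N, ~ N 1 & I `<=` N].
have Pne N x : P N -> N x -> [/\ right_ideal N, ~ N 1 & I `<=` N].
  by case=> [->|].
have [|N [PN Nmax]] := @Zorn_bigcup T P.
  move=> F FP totF; have [F0|/existsNP[N0 /not_implyP[FN0 N00]]] :=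
    pselect (forall N, F N -> N = set0).
    by left; apply/seteqP; split=> // x [N FN]; rewrite (F0 _ FN).
  have /set0P[x0 N0x0] : N0 != set0 by apply/eqP.
  have [rN0 _ IN0] := Pne _ _ (FP _ FN0) N0x0.
  right; split.
  - apply: right_idealP; first by exists N0 => //; exact: rideal0.
    + move=> x y [N1 FN1 N1x] [N2 FN2 N2y].
      have [rN1 _ _] := Pne _ _ (FP _ FN1) N1x.
      have [rN2 _ _] := Pne _ _ (FP _ FN2) N2y.
      have [N12|N21] := totF _ _ FN1 FN2.
        by exists N2 => //; apply: ridealD => //; exact: N12.
      by exists N1 => //; apply: ridealD => //; exact: N21.
    + move=> x a [N1 FN1 N1x]; have [rN1 _ _] := Pne _ _ (FP _ FN1) N1x.
      by exists N1 => //; exact: ridealM.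
  - by move=> [N1 FN1 N11]; have [] := Pne _ _ (FP _ FN1) N11.
  - by move=> x Ix; exists N0 => //; exact: IN0.
have NN0 : N <> set0.
  move=> N0;
  apply: (Nmax I); last by right; split.
  by rewrite N0; split=> // /(_ 0 (rideal0 rI)).
case: PN => [//|[rN N1 IN]]; exists N => //; split; first by split=> //; exists 1.
move=> N' [rN' [x N'x]] NN'; apply: contrapT => neq.
apply: (Nmax N').
  by split=> // sub; apply: neq; apply/seteqP; split.
right; split=> //; last by move=> y /IN /NN'.
by move=> N'1; apply: N'x; rewrite -[x](@mul1r T); exact: ridealM.
Qed.

(** If [(1 - x * a) T] misses 1, it lies in a maximal right ideal, which contains [x * a] and hence
    1. Conversely, a maximal [N] that misses [x] satisfies [N + x T = T], so it contains some
    [1 - x * a]. *)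
Lemma JacP x : Jac_set x <-> forall a, exists u, (1 - x * a) * u = 1.
Proof.
split=> [Jx a|xq].
  apply: contrapT => nu.
  have [|[u /esym u1]|N maxN sub] :=
    @maximal_right_ideal_exists [set z | exists b, z = (1 - x * a) * b].
  - exact: right_ideal_principal.
  - by apply: nu; exists u.
  have [[rN [w Nw]] _] := maxN.
  apply: Nw; rewrite -[w](@mul1r T) -[1](subrK (x * a)); apply: (@ridealM N) => //.
  apply: ridealD => //; first by apply: sub; exists 1; rewrite mulr1.
  by apply: ridealM => //; exact: Jx.
move=> N maxN; have [[rN [w Nw]] Nmax] := maxN.
apply: contrapT => Nx.
pose N' : set T := [set z | exists n a : T, N n /\ z = n + x * a].
have rN' : right_ideal N'.
  apply: right_idealP.
  - by exists 0, 0; split; [exact: rideal0|rewrite mulr0 addr0].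
  - move=> _ _ [n [a [Nn ->]]] [m [b [Nm ->]]].
    by exists (n + m), (a + b); split; [exact: ridealD|rewrite mulrDr addrACA].
  - move=> _ c [n [a [Nn ->]]].
    by exists (n * c), (a * c); split; [exact: ridealM|rewrite mulrDl mulrA].
have NN' : N `<=` N' by move=> n Nn; exists n, 0; rewrite mulr0 addr0.
have [[n [a [Nn /eqP]]]|N'1] := pselect (N' 1); last first.
  apply: Nx; rewrite -(Nmax N') //; last by split=> //; exists 1.
  by exists 0, 1; split; [exact: rideal0|rewrite mulr1 add0r].
rewrite eq_sym -subr_eq0 -addrA -opprB subr_eq0 => /eqP nE.
have [u u1] := xq a; rewrite -nE in u1.
by apply: Nw; rewrite -[w](@mul1r T) -u1 -mulrA; exact: ridealM.
Qed.

Lemma right_ideal_Jac : right_ideal (@Jac_set T).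
Proof.
have [J0 JB Jl Jr] := Jac_subproof T; apply: right_idealP => // [x y Jx Jy|x a];
  last exact: Jr.
by rewrite -[y]opprK -[- y]sub0r; apply: (JB) => //; exact: JB.
Qed.

Lemma Jac_mull a x : Jac_set x -> Jac_set (a * x).
Proof. by have [_ _ Jl _] := Jac_subproof T; exact: Jl. Qed.

(* One-sided quasi-regularity suffices, since it holds for every element of the
   right ideal. *)
Lemma right_ideal_sub_Jac I : right_ideal I ->
  (forall x, I x -> exists u, (1 - x) * u = 1) -> I `<=` @Jac_set T.
Proof. by move=> rI Iq x Ix; apply/JacP => a; apply: Iq; exact: ridealM. Qed.

Lemma Jac_idempotent x : Jac_set x -> x * x = x -> x = 0.
Proof.
move=> /JacP/(_ 1)[u]; rewrite mulr1 => u1 xx.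
by rewrite -[x]mulr1 -u1 mulrA mulrBr mulr1 xx subrr mul0r.
Qed.

Lemma nilpotent_right_quasiregular x n : x ^+ n = 0 -> exists u, (1 - x) * u = 1.
Proof.
move=> xn; exists (\sum_(i < n) x ^+ i).
by have := subrX1 x n; rewrite xn sub0r -[x - 1]opprB mulNr => /oppr_inj <-.
Qed.

End RightIdeals.

Lemma right_ideal_preimage (T Q : pzRingType) (f : {rmorphism T -> Q})
  (I : set Q) : right_ideal I -> right_ideal (f @^-1` I).
Proof.
move=> rI; apply: right_idealP; rewrite /preimage /=.
- by rewrite rmorph0; exact: rideal0.
- by move=> x y Ix Iy; rewrite rmorphD; exact: ridealD.
- by move=> x a Ix; rewrite rmorphM; exact: ridealM.
Qed.

Lemma Jac_image (T Q : pzRingType) (f : {rmorphism T -> Q}) x :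
  surjective f -> Jac_set x -> Jac_set (f x).
Proof.
move=> fs /JacP xq; apply/JacP => b; have [a <-] := fs b.
have [u u1] := xq a; exists (f u).
by rewrite -rmorphM -[1 in LHS](rmorph1 f) -rmorphB -rmorphM u1 rmorph1.
Qed.

(* Equivalent to semiperfectness, but visibly inherited by homomorphic images. *)
Definition idempotent_cover (T : pzRingType) := forall I : set T, right_ideal I ->
  exists e, [/\ I e, e * e = e & forall x, I x -> Jac_set (x - e * x)].

Lemma idempotent_cover_image (T Q : pzRingType) (f : {rmorphism T -> Q}) :
  surjective f -> idempotent_cover T -> idempotent_cover Q.
Proof.
move=> fs Tc I rI.
have [e [Ie ee He]] := Tc _ (@right_ideal_preimage _ _ f I rI).
exists (f e); split=> //; first by rewrite -rmorphM ee.
move=> y Iy; have [x xy] := fs y; rewrite -xy in Iy *.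
by rewrite -rmorphM -rmorphB; apply: Jac_image => //; exact: He.
Qed.

(** For a mere surjection the radical can be too small, as for the integers modulo 4. Here the
    idempotent of the preimage of the radical goes to an idempotent in the radical, hence to 0, so
    [x - e * x] is a radical lift. *)
Lemma Jac_image_cover (T Q : pzRingType) (f : {rmorphism T -> Q}) y :
  surjective f -> idempotent_cover T -> Jac_set y ->
  exists2 x, Jac_set x & f x = y.
Proof.
move=> fs Tc Jy.
have [e [Je ee He]] := Tc _ (@right_ideal_preimage _ _ f _ (@right_ideal_Jac Q)).
have fe : f e = 0 by apply: Jac_idempotent => //; rewrite -rmorphM ee.
have [x xy] := fs y; exists (x - e * x).
  by apply: He; rewrite /preimage /= xy.
by rewrite rmorphB rmorphM fe mul0r subr0.
Qed.

Lemma quotient_proj_surj (R : pzRingType) (I : ideal R) :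
  surjective (@quotient_proj R I).
Proof. by move=> y; exists (repr y); exact: quotient_projK. Qed.

Lemma quotient_proj0 (R : pzRingType) (I : ideal R) x :
  quotient_proj I x = 0 <-> ideal_set I x.
Proof. by rewrite -(raddf0 (quotient_proj I)) quotient_proj_eq subr0. Qed.

Section CoverSemiperfect.
Variable T : pzRingType.
Hypothesis Tc : idempotent_cover T.
Local Notation Q := (quotient_ring (Jac T)).

Lemma cover_quotient (N : set Q) : right_ideal N ->
  exists e, [/\ N e, e * e = e & forall x, N x -> e * x = x].
Proof.
move=> rN; have [e [Ne ee He]] := Tc (right_ideal_preimage (quotient_proj (Jac T)) rN).
exists (quotient_proj (Jac T) e); split=> //; first by rewrite -rmorphM ee.
move=> y; have [x <-] := quotient_proj_surj y => Nx.
by apply/esym; rewrite -rmorphM; apply/quotient_proj_eq; exact: He.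
Qed.

Lemma cover_semisimple : semisimple_module (right_regular Q).
Proof.
move=> N rN; have [e [Ne ee eN]] := cover_quotient rN.
exists [set q : Q | e * q = 0]; split.
- apply: right_idealP => [|x y|x a] /=; first by rewrite mulr0.
    by rewrite mulrDr => -> ->; rewrite addr0.
  by rewrite mulrA => ->; rewrite mul0r.
- apply/seteqP; split=> [x [/eN Nx /=]|x ->]; first by rewrite Nx.
  by split; [exact: (rideal0 rN)|rewrite /= mulr0].
- move=> v; exists ((e : Q) * (v : Q)), ((v : Q) - (e : Q) * (v : Q)); split.
  + exact: (@ridealM Q N e v rN Ne).
  + by rewrite /= mulrBr mulrA ee subrr.
  + by rewrite addrC subrK.
Qed.

(** Infinitely many strict descents would give an infinite direct sum of nonzero right ideals
    [f n Q]. That sum is generated by a single idempotent, which involves only finitely many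
    [f n]. *)
Lemma cover_artinian : right_artinian Q.
Proof.
move=> N rN Ndec.
have Nle m n : (m <= n)%N -> N n `<=` N m.
  move=> /subnK <-; elim: (n - m)%N => // k IH x /Ndec; exact: IH.
have /choice[e eP] n := cover_quotient (rN n).
(* [f n] generates a complement of [N n.+1] in [N n]. *)
pose f n := e n - e n.+1 * e n.
have Nf n m : (m <= n)%N -> N m (f n).
  move=> mn; apply: (Nle _ _ mn).
  have [Nn _ _] := eP n; have [Nn1 _ _] := eP n.+1.
  by apply: ridealB; [exact: rN|exact: Nn|apply: ridealM; [exact: rN|exact: Ndec]].
have ef n : e n.+1 * f n = 0.
  by have [_ ee _] := eP n.+1; rewrite /f mulrBr mulrA ee subrr.
pose H : set Q := [set x | exists m (a : nat -> Q), x = \sum_(i < m) f i * a i].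
have pad m k (a : nat -> Q) : (m <= k)%N ->
    \sum_(i < m) f i * a i = \sum_(i < k) f i * (if (i < m)%N then a i else 0).
  move=> mk; rewrite [RHS](bigID (fun i : 'I_k => (i < m)%N)) /=.
  rewrite [X in _ = _ + X]big1 ?addr0 => [|i /negPf ->]; last by rewrite mulr0.
  rewrite (big_ord_widen _ (fun i => f i * a i) mk).
  by apply: eq_bigr => i ->.
have rH : right_ideal H.
  apply: right_idealP; first by exists 0%N, (fun=> 0); rewrite big_ord0.
  - move=> _ _ [m [a ->]] [k [b ->]].
    rewrite (pad m (maxn m k)) ?leq_maxl // (pad k (maxn m k)) ?leq_maxr //.
    exists (maxn m k), (fun i => (if (i < m)%N then a i else 0) +
      (if (i < k)%N then b i else 0)); rewrite -big_split /=.
    by apply: eq_bigr => i _; rewrite -mulrDr.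
  - move=> _ c [m [a ->]]; exists m, (fun i => a i * c).
    by rewrite mulr_suml; apply: eq_bigr => i _; rewrite mulrA.
have [h [[m [a hE]] _ hH]] := cover_quotient rH.
exists m => k mk.
suff f0 n : (m <= n)%N -> f n = 0.
  have step n : (m <= n)%N -> N n `<=` N n.+1.
    move=> mn x Nx; have [_ _ /(_ x Nx) <-] := eP n.
    have /eqP := f0 n mn; rewrite subr_eq0 => /eqP ->.
    have [N1 _ _] := eP n.+1.
    by rewrite -mulrA; apply: ridealM; [exact: rN|].
  apply/seteqP; split; first exact: Nle.
  move: mk => /subnK <-; elim: (k - m)%N => // j IH x Nx.
  by apply: step; [rewrite leq_addl|exact: IH].
move=> mn.
have Hf : H (f n).
  exists n.+1, (fun i => if i == n then 1 else 0).
  rewrite big_ord_recr /= eqxx mulr1 big1 ?add0r // => i _.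
  by rewrite ltn_eqF ?mulr0.
have fE : f n = \sum_(i < m) f i * (a i * f n).
  rewrite -{1}(hH _ Hf) {1}hE mulr_suml; apply: eq_bigr => i _; by rewrite mulrA.
pose b i := a i * f n.
(* Terms are removed from the left: [f n] and the later terms lie in [N l.+1], so the term of index
   [l] does too. There [e l.+1] acts as the identity, yet it kills that term. *)
suff z l : (l <= m)%N -> f n = \sum_(l <= i < m) f i * b i.
  by rewrite (z m) // big_geq.
elim: l => [_|l IH lm]; first by rewrite big_mkord.
have := IH (ltnW lm); rewrite big_ltn // => fnE.
have Nsum : N l.+1 (\sum_(l.+1 <= i < m) f i * b i).
  rewrite big_nat; apply: (big_ind (N l.+1)); first exact: rideal0 (rN _).
    by move=> x y; exact: (ridealD (rN l.+1)).
  by move=> i /andP[li _]; apply: ridealM; [exact: rN|exact: Nf].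
have Nfl : N l.+1 (f l * b l).
  have -> : f l * b l = f n - \sum_(l.+1 <= i < m) f i * b i by rewrite fnE addrK.
  apply: ridealB; [exact: rN| |exact: Nsum].
  by apply: Nf; exact: leq_trans lm mn.
have [_ _ /(_ _ Nfl)] := eP l.+1.
by rewrite mulrA ef mul0r fnE => <-; rewrite add0r.
Qed.

(** The idempotent [e] of [x T + Jac T] generates the same right ideal as [x] modulo the radical but
    need not be congruent to [x]. Adding [e * x * (1 - e)] keeps it idempotent and corrects this. *)
Lemma cover_idempotents_lift : idempotents_lift (Jac T).
Proof.
move=> x Jx; pose I : set T := [set z | exists a j, Jac_set j /\ z = x * a + j].
have rI : right_ideal I.
  apply: right_idealP.
  - by exists 0, 0; split; [exact: rideal0 (@right_ideal_Jac T)|rewrite mulr0 addr0].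
  - move=> _ _ [a [j [Jj ->]]] [b [k [Jk ->]]]; exists (a + b), (j + k).
    by split; [exact: (ridealD (@right_ideal_Jac T))|rewrite mulrDr addrACA].
  - move=> _ c [a [j [Jj ->]]]; exists (a * c), (j * c).
    by split; [exact: (ridealM c (@right_ideal_Jac T))|rewrite mulrDl mulrA].
have [e [[a [j [Jj eE]]] ee He]] := Tc rI.
have Jex : Jac_set (x - e * x).
  apply: He; exists 1, 0; split; last by rewrite mulr1 addr0.
  exact: rideal0 (@right_ideal_Jac T).
exists (e + e * x * (1 - e)).
  set g := _ * (1 - e).
  have ge : g * e = 0 by rewrite /g -mulrA mulrBl mul1r ee subrr mulr0.
  have eg : e * g = g by rewrite /g !mulrA ee.
  have gg : g * g = 0 by rewrite -{2}eg mulrA ge mul0r.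
  by rewrite mulrDl !mulrDr ee eg ge gg !addr0.
pose p : {rmorphism T -> Q} := quotient_proj (Jac T).
have px : p x * p x = p x by rewrite -rmorphM; apply/quotient_proj_eq.
have pe : p x * p e = p e.
  have pj : p j = 0 by apply/quotient_proj0.
  by rewrite eE rmorphD pj addr0 rmorphM mulrA px.
have pex : p e * p x = p x.
  by rewrite -rmorphM; apply/esym/quotient_proj_eq.
apply/quotient_proj_eq; rewrite -/(p _) -/(p x) rmorphD !rmorphM rmorphB rmorph1.
by rewrite pex mulrBr mulr1 pe addrC subrK.
Qed.

Lemma cover_semiperfect : semiperfect T.
Proof.
split; last exact: cover_idempotents_lift.
by split; [exact: cover_semisimple|exact: cover_artinian].
Qed.

End CoverSemiperfect.

Definition idempotent_acc (T : pzRingType) := forall e : nat -> T,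
  (forall n, [/\ e n * e n = e n, e n * e n.+1 = e n & e n.+1 * e n = e n]) ->
  exists n, e n.+1 = e n.

(** Stated for elements, because a Drazin inverse [a] of [x] yields exactly the idempotent
    [x * a]. *)
Definition semipotent (T : pzRingType) := forall x : T,
  (exists u, (1 - x) * u = 1) \/
  exists a, x * a * (x * a) = x * a /\ x * a <> 0.

(* If the idempotent [e] of [I] is not good enough, there is a nonzero idempotent
   [f] in [(1 - e) I], and [e + f * (1 - e)] is a strictly larger one. *)
Lemma semipotent_cover (T : pzRingType) :
  semipotent T -> idempotent_acc T -> idempotent_cover T.
Proof.
move=> Tsp Tacc I rI; apply: contrapT => nocover.
pose S := {e : T | I e /\ e * e = e}.
have step (s : S) : exists s' : S, [/\ sval s * sval s' = sval s,
    sval s' * sval s = sval s & sval s' <> sval s].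
  case: s => e [Ie ee] /=.
  have [x [Ix Jx]] : exists x, I x /\ ~ Jac_set (x - e * x).
    apply: contrapT => no; apply: nocover; exists e; split=> // x Ix.
    by apply: contrapT => Jx; apply: no; exists x.
  have [a na] : exists a, ~ exists u, (1 - (x - e * x) * a) * u = 1.
    by apply: contrapT => no; apply: Jx; apply/JacP => a; apply: contrapT => na;
      apply: no; exists a.
  case: (Tsp ((x - e * x) * a)) => [//|[b]].
  set f := _ * b => -[ff f0].
  have ef : e * f = 0 by rewrite /f !mulrA mulrBr mulrA ee subrr !mul0r.
  have If : I f.
    do 2!apply: (ridealM _ rI); apply: ridealB => //.
    exact: ridealM.
  have e'e : (e + f * (1 - e)) * e = e.
    by rewrite mulrDl ee -mulrA mulrBl mul1r ee subrr mulr0 addr0.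
  have ee' : e * (e + f * (1 - e)) = e.
    by rewrite mulrDr ee mulrA ef mul0r addr0.
  have fe' : f * (e + f * (1 - e)) = f.
    by rewrite mulrDr mulrA ff mulrBr mulr1 addrC subrK.
  have P' : I (e + f * (1 - e)) /\
      (e + f * (1 - e)) * (e + f * (1 - e)) = e + f * (1 - e).
    split; first by apply: ridealD => //; exact: ridealM.
    rewrite mulrDl ee' -mulrA [(1 - e) * _]mulrBl ee' mul1r.
    by rewrite mulrBr fe' mulrBr mulr1.
  exists (exist _ (e + f * (1 - e)) P') => /=; split=> // e'E.
  apply: f0; have : f * (e + f * (1 - e)) = f * e by rewrite e'E.
  by rewrite fe' => fE; rewrite -ff {1}fE -mulrA ef mulr0.
have S0 : S by exists 0; split; [exact: rideal0|rewrite mul0r].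
have [next nextP] := choice step.
pose e n := sval (iter n next S0).
have [|n eE] := Tacc e.
  move=> n; have [? ? _] := nextP (iter n next S0).
  by split=> //; have [] := svalP (iter n next S0).
by have [_ _] := nextP (iter n next S0); apply.
Qed.

(** * Chain conditions and right artinian rings *)

Section ChainConditions.
Variables (A : pzRingType) (V : lmodType A).
Implicit Types (F N : set V).

(** The chain condition on [V / F], expressed by submodules above [F] so that no quotient module has
    to be formed. *)
Definition dcc_above F := forall N_ : nat -> set V,
  (forall n, submodule (N_ n)) -> (forall n, F `<=` N_ n) ->
  (forall n, N_ n.+1 `<=` N_ n) ->
  exists n, forall m, (n <= m)%N -> N_ m = N_ n.

Definition acc_above F := forall N_ : nat -> set V,
  (forall n, submodule (N_ n)) -> (forall n, F `<=` N_ n) ->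
  (forall n, N_ n `<=` N_ n.+1) ->
  exists n, forall m, (n <= m)%N -> N_ m = N_ n.

Lemma artinian_dcc F : artinian_module V -> dcc_above F.
Proof. by move=> aV N_ sN _; exact: aV. Qed.

Lemma dcc_above0 : artinian_module V -> dcc_above [set 0].
Proof. exact: artinian_dcc. Qed.

Lemma dcc_min F (P : set V -> Prop) N0 : dcc_above F ->
  (forall N, P N -> submodule N /\ F `<=` N) -> P N0 ->
  exists N, [/\ P N, N `<=` N0 & forall N', P N' -> N' `<=` N -> N' = N].
Proof.
move=> dF PF PN0; apply: contrapT => nomin.
pose S := {N : set V | P N /\ N `<=` N0}.
have step (s : S) : exists s' : S, sval s' `<=` sval s /\ sval s' <> sval s.
  case: s => N [PN NN0] /=; apply: contrapT => no; apply: nomin; exists N.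
  split=> // N' PN' N'N; apply: contrapT => neq; apply: no.
  by exists (exist _ N' (conj PN' (subset_trans N'N NN0))).
have [next nextP] := choice step.
pose s0 : S := exist _ N0 (conj PN0 (@subset_refl _ N0)).
have [n|n|n|n nE] := dF (fun n => sval (iter n next s0)).
- by have [/PF[]] := svalP (iter n next s0).
- by have [/PF[]] := svalP (iter n next s0).
- by have [] := nextP (iter n next s0).
by have [_] := nextP (iter n next s0); apply; exact: (nE n.+1 (leqnSn n)).
Qed.

End ChainConditions.

Lemma decreasing_le (T : Type) (N_ : nat -> set T) :
  (forall n, N_ n.+1 `<=` N_ n) -> forall m n, (m <= n)%N -> N_ n `<=` N_ m.
Proof.
move=> dN m n /subnK <-; elim: (n - m)%N => // k IH x /dN; exact: IH.
Qed.

Lemma increasing_le (T : Type) (N_ : nat -> set T) :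
  (forall n, N_ n `<=` N_ n.+1) -> forall m n, (m <= n)%N -> N_ m `<=` N_ n.
Proof.
by move=> dN m n /subnK <-; elim: (n - m)%N => // k IH x /IH; exact: dN.
Qed.

Section Rows.
Variables (B : pzRingType) (N : nat).
Implicit Types U : set 'rV[B]_N.

Definition leading_coefs U (i : 'I_N) : set B :=
  [set a | exists v : 'rV[B]_N,
    [/\ U v, v 0 i = a & forall j : 'I_N, (j < i)%N -> v 0 j = 0]].

Lemma submodule_leading U i : submodule U -> @submodule B B^o (leading_coefs U i).
Proof.
move=> sU; apply: submodP.
- by exists 0; split=> [||j _]; [exact: submod0|rewrite mxE|rewrite mxE].
- move=> _ _ [v [Uv <- v0]] [w [Uw <- w0]]; exists (v + w).
  split=> [||j ji]; [exact: submodD|by rewrite mxE|].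
  by rewrite mxE v0 // w0 // addr0.
- move=> a _ [v [Uv <- v0]]; exists (a *: v).
  split=> [||j ji]; [exact: submodZ|by rewrite mxE|].
  by rewrite mxE v0 // mulr0.
Qed.

(** Echelon reduction: subtracting an element of [U] with the same leading coefficient moves the
    first nonzero entry to the right. The induction is on the number [k] of last entries that may be
    nonzero. *)
Lemma leading_coefs_eq U U' : submodule U -> submodule U' -> U `<=` U' ->
  (forall i, leading_coefs U' i `<=` leading_coefs U i) -> U = U'.
Proof.
move=> sU sU' UU' lU; apply/seteqP; split=> // v0 U'v0.
suff H k : forall v, U' v -> (forall j : 'I_N, (j < N - k)%N -> v 0 j = 0) -> U v.
  by apply: (H N) => // j; rewrite subnn.
elim: k => [v U'v vz|k IH v U'v vz].
  suff -> : v = 0 by exact: (submod0 sU).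
  by apply/rowP => j; rewrite mxE vz // subn0.
have [kN|Nk] := ltnP k N; last first.
  by apply: IH => // j; rewrite (eqP (_ : N - k == 0)%N) // subn_eq0.
have lt : (N - k.+1 < N)%N by rewrite ltn_subrL /= (leq_trans _ kN).
pose i := Ordinal lt.
have [w [Uw wE w0]] : leading_coefs U i (v 0 i) by apply: lU; exists v.
rewrite -[v](subrK w); apply: submodD => //; apply: IH.
  by apply: submodB => //; exact: UU'.
move=> j; rewrite -(subnSK kN) ltnS leq_eqVlt => /orP[/eqP ji|ji].
  by rewrite (_ : j = i) ?mxE ?wE ?subrr //; exact: val_inj.
by rewrite !mxE vz // w0 // subrr.
Qed.

Lemma row_artinian : artinian_module (B^o : lmodType B) ->
  artinian_module ('rV[B]_N : lmodType B).
Proof.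
move=> aB N_ sN dN.
have stab i : exists n, forall m, (n <= m)%N ->
    leading_coefs (N_ m) i = leading_coefs (N_ n) i.
  apply: aB => n; first exact: submodule_leading.
  by move=> a [v [/dN Nv vE v0]]; exists v.
have [n nP] := choice stab.
pose M := \max_i n i.
have nM i : (n i <= M)%N by exact: leq_bigmax.
exists M => m Mm; apply: leading_coefs_eq => //; first exact: decreasing_le.
by move=> i; rewrite (nP i M) ?(nP i m) // (leq_trans _ Mm).
Qed.

End Rows.

(** The target [K] is a parameter so that nilpotency modulo an ideal is covered as well. *)
Definition nilpotent_products (A : pzRingType) (I K : set A) (m : nat) :=
  forall s : seq A, size s = m -> (forall x, x \in s -> I x) -> K (\prod_(x <- s) x).

Lemma nilpotent_productsP (A : pzRingType) (I : ideal A) m :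
  nilpotent_products (ideal_set I) [set 0] m -> nilpotent_ideal I.
Proof.
move=> H; exists m => x Ix; rewrite -(big_map x xpredT id).
apply: H; first by rewrite size_map -[RHS]card_ord cardT enumT [index_enum _]unlock.
by move=> _ /mapP[i _ ->].
Qed.

(** * The Hopkins-Levitzki theorem *)

Section Hopkins.
Variables (A : pzRingType) (V : lmodType A^c) (F : set V).
Hypothesis Ac : idempotent_cover A.
Hypothesis sF : submodule F.
Hypothesis dF : dcc_above F.

Lemma scale_conv (a b : A) (v : V) :
  (b : A^c) *: ((a : A^c) *: v) = ((a * b : A) : A^c) *: v.
Proof. by rewrite scalerA. Qed.

Lemma strict_subsequence (X : nat -> set V) : (forall n, X n `<=` X n.+1) ->
  (exists n, forall m, (n <= m)%N -> X m = X n) \/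
  exists g : nat -> nat, forall k, (g k <= g k.+1)%N /\
    exists y, X (g k.+1) y /\ ~ X (g k) y.
Proof.
move=> iX; have [//|no] := pselect (exists n, forall m, (n <= m)%N -> X m = X n).
  by left.
right; have step n : exists m, (n <= m)%N /\ exists y, X m y /\ ~ X n y.
  apply: contrapT => nom; apply: no; exists n => m nm; apply/seteqP; split.
    by move=> y Xy; apply: contrapT => Xny; apply: nom; exists m; split=> //; exists y.
  exact: increasing_le.
have [next nextP] := choice step.
by exists (fun k => iter k next 0%N) => k; exact: nextP.
Qed.

(* Cutting the [y k] down by idempotents to [z k] makes the sum of the submodules
   generated by the [z k] direct modulo [W'], so its tails descend strictly. *)
Lemma layer_acc (W' W : set V) (X : nat -> set V) : submodule W' -> F `<=` W' ->
  (forall n w, @Jac_set A n -> W w -> W' ((n : A^c) *: w)) ->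
  (forall n, submodule (X n)) -> (forall n, W' `<=` X n) -> (forall n, X n `<=` W) ->
  (forall n, X n `<=` X n.+1) ->
  exists n, forall m, (n <= m)%N -> X m = X n.
Proof.
move=> sW' FW' WJ sX W'X XW iX.
case: (strict_subsequence iX) => // -[g gP].
have /choice[y yP] k : exists y, X (g k.+1) y /\ ~ X (g k) y by have [] := gP k.
have gle := increasing_le iX.
have gmono m n : (m <= n)%N -> X (g m) `<=` X (g n).
  by apply: (@increasing_le _ (fun k => X (g k))) => k; apply: gle; have [] := gP k.
have rI k : right_ideal [set a : A | X (g k) ((a : A^c) *: y k)].
  apply: right_idealP; rewrite /=.
  - by rewrite scale0r; exact: submod0.
  - by move=> a b Xa Xb; rewrite (scalerDl (y k) (a : A^c) b); exact: submodD.
  - by move=> a b Xa; rewrite -scale_conv; exact: submodZ.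
have /choice[e eP] k := Ac (rI k).
pose z k := ((1 - e k : A) : A^c) *: y k.
have zE k : z k = y k - (e k : A^c) *: y k by rewrite /z scalerBl scale1r.
have zX k : X (g k.+1) (z k).
  have [yX _] := yP k; rewrite zE; apply: submodB => //.
  by apply: gmono (leqnSn k) _ _; have [] := eP k.
have zN k : ~ X (g k) (z k).
  move=> Xz; have [_ nX] := yP k; apply: nX.
  have [ex _ _] := eP k; rewrite /= in ex.
  by apply: submodTR ex => //; rewrite -zE.
(* If [b] sends [z k] into [X (g k)], then [(1 - e k) * b] annihilates [y k] modulo [X (g k)] and is
   killed by [e k], so it is radical. It therefore moves [y k] from [W] into [W']. *)
have zW' k (b : A) : X (g k) ((b : A^c) *: z k) -> W' ((b : A^c) *: z k).
  rewrite /z scale_conv => Xb; have [_ ee /(_ _ Xb)] := eP k.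
  rewrite mulrA mulrBr mulr1 ee subrr mul0r subr0 => Jb.
  by apply: WJ => //; apply: XW (g k.+1) _ _; have [] := yP k.
pose D m : set V := [set v | exists w l (a : nat -> A^c),
  W' w /\ v = w + \sum_(m <= i < l) a i *: z i].
have pad m l k (a : nat -> A^c) : (l <= k)%N -> \sum_(m <= i < l) a i *: z i =
    \sum_(m <= i < k) (if (i < l)%N then a i else 0) *: z i.
  move=> lk; rewrite (big_nat_widen _ _ _ _ _ lk) big_mkcond /=.
  by apply: eq_bigr => i _; case: ifP => // _; rewrite scale0r.
have sD m : submodule (D m).
  apply: submodP.
  - by exists 0, 0%N, (fun=> 0); rewrite big_geq // addr0; split=> //; exact: submod0.
  - move=> _ _ [w [l [a [Ww ->]]]] [w' [l' [a' [Ww' ->]]]].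
    exists (w + w'), (maxn l l'), (fun i => (if (i < l)%N then a i else 0) +
       (if (i < l')%N then a' i else 0)); split; first exact: submodD.
    rewrite (pad m l (maxn l l')) ?leq_maxl // (pad m l' (maxn l l')) ?leq_maxr //.
    rewrite addrACA -big_split; congr (_ + _).
    by apply: eq_bigr => i _; rewrite scalerDl.
  - move=> b _ [w [l [a [Ww ->]]]]; exists (b *: w), l, (fun i => b * a i).
    split; first exact: submodZ.
    rewrite scalerDr scaler_sumr; congr (_ + _).
    by apply: eq_bigr => i _; rewrite scalerA.
(* In such a relation the last term lies in [X (g l)] because all the others do, hence in [W'], and
   it is absorbed into [w]. *)
have zD m : ~ D m.+1 (z m).
  move=> [w [l [a [Ww]]]]; elim: l w Ww => [|l IH] w Ww.
    rewrite big_geq // addr0 => zw; apply: (zN m); apply: W'X; by rewrite zw.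
  have [ml|lm] := leqP m.+1 l; last first.
    rewrite big_geq // addr0 => zw; apply: (zN m); apply: W'X; by rewrite zw.
  rewrite big_nat_recr //= addrA => zmE; apply: (IH (w + a l *: z l)); last first.
    by rewrite zmE addrAC.
  apply: submodD => //; apply: zW'.
  have -> : a l *: z l = z m - (w + \sum_(m.+1 <= i < l) a i *: z i).
    by rewrite zmE [RHS]addrC addKr.
  apply: submodB => //; first exact: (gmono _ _ ml).
  apply: submodD => //; first exact: W'X.
  rewrite big_nat; apply: (big_ind (X (g l))); first exact: submod0.
    by move=> u v; exact: submodD.
  by move=> i /andP[_ il]; apply: submodZ => //; exact: (gmono _ _ il).
have [n|n|n|n nE] := dF (N_ := D).
- exact: sD.
- move=> v /FW' Wv; exists v, 0%N, (fun=> 0); by rewrite big_geq // addr0.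
- move=> _ [w [l [a [Ww ->]]]].
  have [ln|nl] := leqP l n.+1.
    by exists w, 0%N, (fun=> 0); rewrite !big_geq.
  exists w, l, (fun i => if (i == n)%N then 0 else a i); split=> //.
  rewrite [in RHS]big_ltn ?(ltnW nl) // eqxx scale0r add0r; congr (_ + _).
  by apply: eq_big_nat => i /andP[ni _]; rewrite gtn_eqF.
exfalso; apply: (zD n); rewrite (nE n.+1) //.
exists 0, n.+1, (fun=> 1); split; first exact: submod0.
by rewrite big_nat1 scale1r add0r.
Qed.

(** [Jac_layer i / F] is the annihilator in [V / F] of the [i]-th power of the radical, so the
    radical kills the successive quotients. *)
Fixpoint Jac_layer i : set V :=
  if i is i'.+1 then [set v | forall n : A, Jac_set n -> Jac_layer i' ((n : A^c) *: v)]
  else F.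

Lemma submodule_layer i : submodule (Jac_layer i).
Proof.
elim: i => //= i IH; apply: submodP => /=.
- by move=> n _; rewrite scaler0; exact: submod0.
- by move=> x y Zx Zy n Jn; rewrite scalerDr; apply: submodD => //; [exact: Zx|exact: Zy].
- by move=> a x Zx n Jn; rewrite scale_conv; apply: Zx; exact: Jac_mull.
Qed.

Lemma layerS i : Jac_layer i `<=` Jac_layer i.+1.
Proof.
by move=> v Zv n Jn; apply: submodZ => //; exact: submodule_layer.
Qed.

Lemma layer_all m : (forall v, exists2 K : set A, nilpotent_products (@Jac_set A) K m &
    forall a, K a -> F ((a : A^c) *: v)) -> forall v, Jac_layer m v.
Proof.
move=> H v; have {H}[K KP KF] := H v.
have : forall s : seq A, size s = m -> (forall x, x \in s -> Jac_set x) ->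
   F ((\prod_(x <- s) x : A^c) *: v).
  by move=> s sm sJ; apply: KF; exact: KP.
elim: m v {KP KF} => [v /(_ [::] erefl)|m IH v H n Jn /=].
  by rewrite big_nil scale1r; apply.
apply: IH => s sm sJ; rewrite scale_conv.
have := H (n :: s); rewrite big_cons /= sm; apply=> // x.
by rewrite in_cons => /orP[/eqP ->|/sJ].
Qed.

(** Induction on the layers by the modular law: inside [Jac_layer i.+1] the chain is stationary once
    it is so in [Jac_layer i] and modulo [Jac_layer i]. *)
Lemma layers_acc m : (forall v, Jac_layer m v) -> acc_above F.
Proof.
move=> Zm X sX FX iX.
suff H i : exists n, forall k, (n <= k)%N -> forall v, X k v -> Jac_layer i v -> X n v.
  have [n nP] := H m; exists n => k nk; apply/seteqP; split.
    by move=> v Xv; exact: (nP k).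
  exact: increasing_le.
elim: i => [|i [n1 IH]]; first by exists 0%N => k _ v _ /FX.
have FZ j : F `<=` Jac_layer j.
  by elim: j => // j FZ v /FZ; exact: (@layerS j).
have [k|k|k|k|n2 n2P] := @layer_acc (Jac_layer i) (Jac_layer i.+1)
  (fun k => sumset (X k `&` Jac_layer i.+1) (Jac_layer i)) (submodule_layer i) (FZ i)
  (fun n w Jn Zw => Zw n Jn).
- apply: submodule_sumset (submodule_layer i).
  exact: submoduleI (sX k) (submodule_layer i.+1).
- move=> v Zv; exists 0, v; split=> //; last by rewrite add0r.
  by split; [exact: submod0|exact: (submod0 (submodule_layer i.+1))].
- move=> _ [x [z [[_ Zx] Zz ->]]].
  exact: (submodD (submodule_layer i.+1) Zx (layerS Zz)).
- by move=> _ [x [z [[Xx Zx] Zz ->]]]; exists x, z; split=> //; split=> //; exact: iX.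
exists (maxn n1 n2) => k; rewrite geq_max => /andP[k1 k2] v Xv Zv.
have le := increasing_le iX.
have : sumset (X n2 `&` Jac_layer i.+1) (Jac_layer i) v.
  rewrite -(n2P k k2); exists v, 0; split=> //; last by rewrite addr0.
  exact: (submod0 (submodule_layer i)).
move=> [x [z [[Xx _] Zz vE]]].
have Xz : X n1 z.
  apply: (IH k k1) => //; have -> : z = v - x by rewrite vE addrC addKr.
  by apply: (submodB (sX k) Xv); exact: (le n2 _ k2).
rewrite vE; apply: (submodD (sX _)); first exact: (le n2 _ (leq_maxr n1 n2)).
exact: (le n1 _ (leq_maxl n1 n2) z Xz).
Qed.

Lemma hopkins m : nilpotent_products (@Jac_set A) [set 0] m -> acc_above F.
Proof.
move=> Jm; apply: (@layers_acc m); apply: layer_all => v; exists [set 0] => // _ ->.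
by rewrite scale0r; exact: submod0.
Qed.

End Hopkins.

(** * Nilpotent radical and idempotents of right artinian rings *)

Section RightArtinian.
Variable A : pzRingType.
Hypothesis Aart : right_artinian A.

Lemma artinian_dcc_ideals : @dcc_above A^c (right_regular A) [set 0].
Proof. exact: dcc_above0. Qed.

Lemma right_ideal_min (P : set A -> Prop) (I : set A) :
  (forall N, P N -> right_ideal N) -> P I ->
  exists N, [/\ P N, N `<=` I & forall N', P N' -> N' `<=` N -> N' = N].
Proof.
move=> PP PI; apply: (dcc_min artinian_dcc_ideals) => // N /PP rN; split=> // _ ->.
exact: (rideal0 rN).
Qed.

(** The powers of the radical, given as intersections of right ideals to avoid finite sums. *)
Fixpoint Jac_power i : set A :=
  if i is i'.+1 then [set x | forall K : set A, right_ideal K ->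
    (forall j p, Jac_set j -> Jac_power i' p -> K (j * p)) -> K x]
  else setT.

Lemma right_ideal_Jac_power i : right_ideal (Jac_power i).
Proof.
case: i => [|i] /=; first by apply: right_idealP.
apply: right_idealP => [K rK _|x y Px Py K rK H|x a Px K rK H].
- exact: rideal0.
- by apply: ridealD => //; [exact: Px|exact: Py].
- by apply: ridealM => //; exact: Px.
Qed.

(** The powers stabilize at some [P] with [Jac * P = P]. If [P] is nonzero, take a right ideal [K]
    minimal with [K * P] nonzero, and [a] in [K] with [a * P] nonzero. Then [a * Jac] equals [K] by
    minimality and contains [a], and [a = a * i] with [i] radical forces [a = 0]. *)
Lemma artinian_Jac_nilpotent : exists m, nilpotent_products (@Jac_set A) [set 0] m.
Proof.
have dP i : Jac_power i.+1 `<=` Jac_power i.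
  elim: i => // i IH x Px K rK H; apply: Px => // j p Jj Pp.
  by apply: H => //; exact: IH.
have prodP s : (forall x, x \in s -> Jac_set x) ->
    Jac_power (size s) (\prod_(x <- s) x).
  elim: s => [|x s IH] xJ; first by [].
  move=> K rK H; rewrite big_cons; apply: H; first by apply: xJ; rewrite mem_head.
  by apply: IH => y ys; apply: xJ; rewrite in_cons ys orbT.
have [n nE] := @Aart Jac_power right_ideal_Jac_power dP.
exists n => s sn sJ; apply: contrapT => s0.
have Ps : Jac_power n (\prod_(x <- s) x) by rewrite -sn; exact: prodP.
pose PP (K : set A) := right_ideal K /\ exists a p, [/\ K a, Jac_power n p & a * p <> 0].
have [|K [[rK [a [p [Ka Pp ap]]]] _ Kmin]] :=
    @right_ideal_min PP setT (fun N PN => proj1 PN).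
  split; first exact: right_idealP.
  by exists 1, (\prod_(x <- s) x); rewrite mul1r.
have [j [q [Jj Pq jq]]] : exists j q, [/\ Jac_set j, Jac_power n q & a * (j * q) <> 0].
  apply: contrapT => no; apply: ap.
  have := Pp; rewrite -(nE n.+1) // => /(_ [set x | a * x = 0]); apply.
    apply: right_idealP => [|x y|x b] /=; first by rewrite mulr0.
      by rewrite mulrDr => -> ->; rewrite addr0.
    by rewrite mulrA => ->; rewrite mul0r.
  by move=> j q Jj Pq; apply: contrapT => jq; apply: no; exists j, q.
pose K' : set A := [set x | exists2 j, Jac_set j & x = a * j].
have K'K : K' = K.
  apply: Kmin; last by move=> _ [i Ji ->]; exact: ridealM.
  split; last by exists (a * j), q; rewrite -mulrA; split=> //; exists j.
  apply: right_idealP.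
  - by exists 0; [exact: rideal0 (@right_ideal_Jac A)|rewrite mulr0].
  - move=> _ _ [i Ji ->] [k Jk ->]; exists (i + k); last by rewrite mulrDr.
    exact: (ridealD (@right_ideal_Jac A)).
  - move=> _ b [i Ji ->]; exists (i * b); last by rewrite mulrA.
    exact: (ridealM b (@right_ideal_Jac A)).
move: Ka; rewrite -K'K => -[i Ji ai].
have [u u1] := (JacP i).1 Ji 1; rewrite mulr1 in u1.
have a0 : a = 0 by rewrite -[a]mulr1 -u1 mulrA mulrBr mulr1 -ai subrr mul0r.
by apply: ap; rewrite a0 mul0r.
Qed.

(** Let [I] be minimal among the right ideals in [x A] that are not radical. It contains [a] and [e]
    with [a = a * e] nonzero, and the annihilator of [a] in [I] is radical. So [e * (1 - e)] is
    nilpotent, and a polynomial in [e] is a nonzero idempotent. *)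
Lemma artinian_semipotent : semipotent A.
Proof.
have [m Jm] := artinian_Jac_nilpotent.
have Jnil (x : A) : Jac_set x -> x ^+ m = 0.
  move=> Jx; have := Jm (nseq m x); rewrite size_nseq big_nseq => /(_ erefl) H.
  by rewrite -iter_mulr_1; apply: H => y /nseqP[->].
move=> x; have [|xnq] := pselect (exists u, (1 - x) * u = 1); first by left.
right; pose PP (K : set A) := right_ideal K /\ ~ (K `<=` @Jac_set A).
have [|I [[rI IJ] Ix Imin]] :=
    @right_ideal_min PP [set z | exists a, z = x * a] (fun N PN => proj1 PN).
  split; first exact: right_ideal_principal.
  move=> /(_ x) H; apply: xnq; have /JacP/(_ 1) : Jac_set x.
    by apply: H; exists 1; rewrite mulr1.
  by rewrite mulr1.
(* Otherwise all squares of elements of [I] lie in the nilpotent radical, and the nil right ideal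
   [I] would be radical. *)
have [a [b [Ia Ib ab]]] : exists a b, [/\ I a, I b & ~ Jac_set (a * b)].
  apply: contrapT => no; apply: IJ; apply: right_ideal_sub_Jac => // y Iy.
  apply: (@nilpotent_right_quasiregular _ y (2 * m)).
  rewrite exprM expr2; apply: Jnil; apply: contrapT => yy.
  by apply: no; exists y, y.
have aIE : [set z | exists2 y, I y & z = a * y] = I.
  apply: Imin; last by move=> _ [y Iy ->]; exact: ridealM.
  split; last by move=> H; apply: ab; apply: H; exists b.
  apply: right_idealP.
  - by exists 0; [exact: rideal0|rewrite mulr0].
  - by move=> _ _ [y Iy ->] [z Iz ->]; exists (y + z); [exact: ridealD|rewrite mulrDr].
  - by move=> _ c [y Iy ->]; exists (y * c); [exact: ridealM|rewrite mulrA].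
have a0 : a <> 0.
  by move=> a0; apply: ab; rewrite a0 mul0r; exact: (rideal0 (@right_ideal_Jac A)).
have [e Ie ae] : exists2 e, I e & a = a * e by move: Ia; rewrite -{1}aIE.
have annJ : [set y | I y /\ a * y = 0] `<=` @Jac_set A.
  apply: contrapT => nJ.
  have /seteqP[_ /(_ e Ie)[_]] : [set y | I y /\ a * y = 0] = I.
    apply: Imin; last by move=> y [].
    split=> //; apply: right_idealP.
    - by split; [exact: rideal0|rewrite mulr0].
    - by move=> y z [Iy ay] [Iz az]; split; [exact: ridealD|rewrite mulrDr ay az addr0].
    - by move=> y c [Iy ay]; split; [exact: ridealM|rewrite mulrA ay mul0r].
  by rewrite -ae.
have [n en] : exists n, (e * (1 - e)) ^+ n.+1 = 0.
  exists m; rewrite exprS Jnil ?mulr0 //; apply: annJ; split; first exact: ridealM.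
  by rewrite mulrA -ae mulrBr mulr1 -ae subrr.
(* [w] is a multiple of [e] and [1 - w] is a power of [1 - e], so [w ^+ n.+1 * (1 - w) = 0] and
   [w ^+ n.+1] is idempotent. It is nonzero because [a * w = a], which needs a positive exponent. *)
pose w := 1 - (1 - e) ^+ n.+1.
have wE : w = e * \sum_(i < n.+1) (1 - e) ^+ i.
  have := subrX1 (1 - e) n.+1.
  have -> : 1 - e - 1 = - e by rewrite addrAC subrr sub0r.
  by rewrite mulNr /w => H; rewrite -opprB H opprK.
have ec : GRing.comm e (1 - e).
  by apply: commrB; [exact: commr1|exact: commr_refl].
have ew : e ^+ n.+1 * (1 - w) = 0.
  by rewrite /w opprB addrC subrK -exprMn_comm.
have wec : GRing.comm e (\sum_(i < n.+1) (1 - e) ^+ i).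
  by apply: commr_sum => i _; apply: commrX.
have ww : w ^+ n.+1 * w = w ^+ n.+1.
  apply/eqP; rewrite -subr_eq0 -{2}[w ^+ _]mulr1 -mulrBr -opprB mulrN oppr_eq0.
  have ec' := commrX n.+1 (commr_sym (commrX n.+1 (commr_sym wec))).
  by rewrite {1}wE exprMn_comm // ec' -mulrA ew mulr0.
have wwk k : w ^+ n.+1 * w ^+ k = w ^+ n.+1.
  by elim: k => [|k IH]; rewrite ?expr0 ?mulr1 // (exprS w k) mulrA ww.
have aw : a * w = a.
  by rewrite /w exprS mulrBr mulr1 mulrA mulrBr mulr1 -ae subrr mul0r subr0.
have awk k : a * w ^+ k = a.
  by elim: k => [|k IH]; rewrite ?expr0 ?mulr1 // (exprS w k) mulrA aw.
have [c xc] : exists c, w ^+ n.+1 = x * c.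
  have [d ed] := Ix e Ie.
  by rewrite exprS wE ed -!mulrA; eexists.
exists c; rewrite -xc; split=> // w0.
by apply: a0; rewrite -(awk n.+1) w0 mulr0.
Qed.

Lemma artinian_idempotent_acc : idempotent_acc A.
Proof.
move=> e eP.
have [||n nE] := @Aart (fun n => [set y : A | e n * y = 0]).
- move=> n; apply: right_idealP => [|x y|x b] /=; first by rewrite mulr0.
    by rewrite mulrDr => -> ->; rewrite addr0.
  by rewrite mulrA => ->; rewrite mul0r.
- by move=> n y /= ey; have [_ <- _] := eP n; rewrite -mulrA ey mulr0.
exists n; have [ee _ e'e] := eP n.
have : [set y : A | e n.+1 * y = 0] (1 - e n).
  by rewrite (nE n.+1) //= mulrBr mulr1 ee subrr.
by rewrite /= mulrBr mulr1 e'e => /eqP; rewrite subr_eq0 => /eqP.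
Qed.

Lemma artinian_cover : idempotent_cover A.
Proof. exact: semipotent_cover artinian_semipotent artinian_idempotent_acc. Qed.

End RightArtinian.

Lemma right_artinian_acc (A : pzRingType) (V : lmodType A^c) (F : set V) :
  right_artinian A -> submodule F -> dcc_above F -> acc_above F.
Proof.
move=> Aart sF dF; have [m Jm] := artinian_Jac_nilpotent Aart.
exact: hopkins (artinian_cover Aart) sF dF m Jm.
Qed.

(** * Drazin inverses in centralizers *)

Section Centralizer.
Variables (E : pzRingType) (X : set E).

Definition centralizer_mem : {pred E} := fun x => `[< forall a, X a -> a * x = x * a >].

Lemma centralizer_subring : GRing.subring_closed centralizer_mem.
Proof.
split; first by apply/asboolP => a _; rewrite mulr1 mul1r.
  move=> x y /asboolP Cx /asboolP Cy; apply/asboolP => a Xa.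
  by rewrite mulrBl mulrBr Cx ?Cy.
move=> x y /asboolP Cx /asboolP Cy; apply/asboolP => a Xa.
by rewrite mulrA Cx // -mulrA Cy // mulrA.
Qed.

Record centralizer :=
  Centralizer { centralizer_val : E; _ : centralizer_val \in centralizer_mem }.

HB.instance Definition _ := [isSub for centralizer_val].
HB.instance Definition _ := [Choice of centralizer by <:].
HB.instance Definition _ := 
  GRing.SubChoice_isSubPzRing.Build E centralizer_mem centralizer centralizer_subring.

Lemma centralizerP (f : centralizer) a : X a -> a * val f = val f * a.
Proof. by move=> Xa; have /asboolP/(_ a Xa) := valP f. Qed.

Lemma centralizer_mk x : (forall a, X a -> a * x = x * a) ->
  exists f : centralizer, val f = x.
Proof. by move=> Cx; exists (Centralizer (asboolT Cx)). Qed.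

End Centralizer.

Section Endo.
Variables (A : pzRingType) (V : lmodType A).
Implicit Types f g : endo V.

Lemma endoB f x y : f (x - y) = f x - f y. Proof. exact: linearB. Qed.
Lemma endoDv f x y : f (x + y) = f x + f y. Proof. exact: linearD. Qed.
Lemma endoZ f a x : f (a *: x) = a *: f x. Proof. exact: linearZ. Qed.
Lemma endo0v f : f 0 = 0. Proof. exact: linear0. Qed.
Lemma endoME f g x : (f * g) x = f (g x). Proof. by []. Qed.
Lemma endoXS f n x : (f ^+ n.+1) x = f ((f ^+ n) x).
Proof. by rewrite exprS. Qed.
Lemma endoXD f m n x : (f ^+ (m + n)) x = (f ^+ m) ((f ^+ n) x).
Proof. by rewrite exprD. Qed.

Lemma endo_mk (h : V -> V) : linear h -> exists f : endo V, forall x, f x = h x.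
Proof.
move=> hl; pose hM := GRing.isLinear.Build _ _ _ _ h hl.
by pose hL : {linear V -> V} := HB.pack h hM; exists hL.
Qed.

End Endo.

Section CompleteFiltration.
Variables (A : pzRingType) (V : lmodType A).

(** Both chain conditions together say that [V / F k] has finite length. Invariance under all of
    [End V] lets Fitting's lemma be applied modulo [F k]. *)
Record complete_filtration (F : nat -> set V) : Prop := CompleteFiltration {
  filt_sub : forall k, submodule (F k);
  filt_dec : forall k, F k.+1 `<=` F k;
  filt_endo : forall (f : endo V) k v, F k v -> F k (f v);
  filt_dcc : forall k, dcc_above (F k);
  filt_acc : forall k, acc_above (F k);
  filt_sep : forall v, (forall k, F k v) -> v = 0;
  filt_complete : forall v : nat -> V, (forall k, F k (v k.+1 - v k)) ->
    exists w, forall k, F k (w - v k) }.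

Variable F : nat -> set V.
Hypothesis cF : complete_filtration F.
Let sF k := filt_sub cF k.

Lemma filt_subTR k x y : F k (x - y) -> F k y -> F k x.
Proof. exact: submodTR. Qed.

Lemma filt_subC k x y : F k (x - y) -> F k (y - x).
Proof. by rewrite -opprB; move=> H; rewrite -[y - x]opprK; exact: submodN. Qed.

Section Drazin.
Variable x : endo V.

Lemma fitting_index k : exists n,
  (forall m w, exists w', F k ((x ^+ n) w - (x ^+ m) w')) /\
  (forall m v, F k ((x ^+ m) v) -> F k ((x ^+ n) v)).
Proof.
have [n|n|n|a aE] := filt_dcc cF (k := k)
  (N_ := fun n => [set u | exists w, F k (u - (x ^+ n) w)]).
- apply: submodP => /=.
  + by exists 0; rewrite endo0v subr0; exact: submod0.
  + move=> u v [w Fu] [w' Fv]; exists (w + w').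
    by rewrite endoDv opprD addrACA; exact: submodD.
  + by move=> c u [w Fu]; exists (c *: w); rewrite endoZ -scalerBr; exact: submodZ.
- by move=> u Fu; exists 0; rewrite endo0v subr0.
- by move=> u [w Fu]; exists (x w); rewrite exprSr in Fu.
have [n|n|n|b bE] := filt_acc cF (k := k) (N_ := fun n => [set u | F k ((x ^+ n) u)]).
- apply: submodP => /=.
  + by rewrite endo0v; exact: submod0.
  + by move=> u v Fu Fv; rewrite endoDv; exact: submodD.
  + by move=> c u Fu; rewrite endoZ; exact: submodZ.
- by move=> u Fu; exact: filt_endo.
- by move=> u /= Fu; rewrite endoXS; exact: filt_endo.
have bP m v : F k ((x ^+ m) v) -> F k ((x ^+ b) v).
  move=> Fm; suff : [set u | F k ((x ^+ maxn b m) u)] v by rewrite (bE _ (leq_maxl b m)).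
  by rewrite /= -(subnK (leq_maxr b m)) endoXD; exact: filt_endo.
have aP m w : exists w', F k ((x ^+ a) w - (x ^+ m) w').
  have : [set u | exists w, F k (u - (x ^+ maxn a m) w)] ((x ^+ a) w).
    by rewrite (aE _ (leq_maxl a m)); exists w; rewrite subrr; exact: submod0.
  move=> [w' Fw]; exists ((x ^+ (maxn a m - m)) w').
  by rewrite -endoXD subnKC ?leq_maxr.
(* [a] bounds the descending images and [b] the ascending kernels; their sum serves both. *)
exists (a + b)%N; split=> [m w|m v Fm].
  have [w' Fw] := aP m ((x ^+ b) w).
  by exists w'; rewrite endoXD.
by rewrite endoXD; apply: filt_endo => //; exact: (bP m).
Qed.

(* Modulo [F k], [u] is the image of [v] under the Drazin inverse of [x]. *)
Definition drazin_rel k v u := (forall n, exists w, F k (u - (x ^+ n) w)) /\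
  exists n, F k ((x ^+ n) (v - x u)).

Lemma drazin_rel_ex k v : exists u, drazin_rel k v u.
Proof.
have [n [im _]] := fitting_index k.
(* The exponent is chosen so that [u = x^n w] satisfies [x^n (x u) = x^(n+n+1) w], which is [x^n v]
   modulo [F k]. *)
have [w Fw] := im (n + n.+1)%N v.
exists ((x ^+ n) w); split=> [m|]; first exact: im.
by exists n; rewrite endoB -endoXS -endoXD.
Qed.

(** The difference lies in the stable image and in the stable kernel of [x] modulo [F k], and these
    meet in 0. *)
Lemma drazin_rel_uniq k v u u' : drazin_rel k v u -> drazin_rel k v u' -> F k (u - u').
Proof.
move=> [imu [a Fa]] [imu' [b Fb]]; have [n [_ ker]] := fitting_index k.
have [w Fw] := imu n; have [w' Fw'] := imu' n.
have xd : F k ((x ^+ n) (u - u')).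
  apply: (ker (a + b).+1); rewrite exprSr endoME.
  have -> : x (u - u') = (v - x u') - (v - x u) by rewrite endoB opprB [RHS]addrC subrKA.
  rewrite endoB; apply: submodB => //; first by rewrite endoXD; exact: filt_endo.
  by rewrite addnC endoXD; exact: filt_endo.
have Fd : F k ((u - u') - (x ^+ n) (w - w')).
  have -> : (u - u') - (x ^+ n) (w - w') = (u - (x ^+ n) w) - (u' - (x ^+ n) w').
    by rewrite endoB !opprB [u - u']addrC addrACA [LHS]addrC [- u' + _]addrC.
  exact: submodB.
have : F k ((x ^+ n) (w - w')).
  apply: (ker (n + n)%N); rewrite endoXD.
  apply: filt_subTR xd; rewrite -endoB; apply: filt_endo => //.
  exact: filt_subC.
exact: filt_subTR.
Qed.

Lemma drazin_rel_linear k a v u v' u' :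
  drazin_rel k v u -> drazin_rel k v' u' -> drazin_rel k (a *: v + v') (a *: u + u').
Proof.
move=> [im [n Fn]] [im' [m Fm]]; split=> [l|].
  have [w Fw] := im l; have [w' Fw'] := im' l; exists (a *: w + w').
  rewrite endoDv endoZ opprD addrACA -scalerBr.
  by apply: submodD => //; exact: submodZ.
exists (n + m)%N; rewrite [x (_ + _)]endoDv [x (_ *: _)]endoZ opprD addrACA.
rewrite -scalerBr endoDv endoZ.
apply: submodD => //; last by rewrite endoXD; exact: filt_endo.
by apply: submodZ => //; rewrite addnC endoXD; exact: filt_endo.
Qed.

Lemma drazin_rel_shift k v u u' : F k (u' - u) -> drazin_rel k v u -> drazin_rel k v u'.
Proof.
move=> Fu [im [n Fn]]; split=> [m|].
  have [w Fw] := im m; exists w; rewrite -[u'](subrK u) -addrA; exact: submodD.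
exists n; have -> : v - x u' = (v - x u) - x (u' - u).
  by rewrite endoB opprB addrA subrK.
by rewrite endoB; apply: submodB => //; do 2!apply: (filt_endo cF).
Qed.

Lemma drazin_rel_dec k v u : drazin_rel k.+1 v u -> drazin_rel k v u.
Proof.
move=> [im [n Fn]]; split=> [m|]; last by exists n; exact: filt_dec.
by have [w Fw] := im m; exists w; exact: filt_dec.
Qed.

Lemma drazin_rel_comm k (g : endo V) v u : g * x = x * g ->
  drazin_rel k v u -> drazin_rel k (g v) (g u).
Proof.
move=> gx [im [n Fn]].
have gxn m w : g ((x ^+ m) w) = (x ^+ m) (g w).
  have : GRing.comm g (x ^+ m) by exact: commrX.
  by move=> H; rewrite -!endoME H.
split=> [m|].
  by have [w Fw] := im m; exists (g w); rewrite -gxn -endoB; exact: filt_endo.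
exists n; rewrite -[x (g u)]endoME -gx endoME -endoB -gxn.
exact: filt_endo.
Qed.

Lemma drazin_inverse : exists y : endo V,
  [/\ forall g : endo V, g * x = x * g -> g * y = y * g,
      y * (x * y) = y &
      forall k, exists n, forall v, F k ((x ^+ n) (v - x (y v)))].
Proof.
have ex v : exists u, forall k, drazin_rel k v u.
  have [u uP] := choice (drazin_rel_ex ^~ v).
  have [k|w wP] := filt_complete cF (v := u).
    by apply: drazin_rel_uniq; [apply: drazin_rel_dec|]; exact: uP.
  by exists w => k; apply: drazin_rel_shift (uP k).
have [h hP] := choice ex.
have uniq v u u' : (forall k, drazin_rel k v u) -> (forall k, drazin_rel k v u') -> u = u'.
  move=> Hu Hu'; apply/eqP; rewrite -subr_eq0; apply/eqP; apply: (filt_sep cF) => k.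
  exact: (drazin_rel_uniq (Hu k) (Hu' k)).
have hl : linear h.
  by move=> a v w; apply: (uniq (a *: v + w)) => // k; exact: drazin_rel_linear.
have [y yE] := endo_mk hl.
have yP v k : drazin_rel k v (y v) by rewrite yE.
exists y; split.
- move=> g gx; apply: linear_ext => v; rewrite -[LHS]/(g (y v)) -[RHS]/(y (g v)).
  by apply: (uniq (g v)) => // k; exact: drazin_rel_comm.
- apply: linear_ext => v; rewrite -[LHS]/(y (x (y v))).
  apply/esym/eqP; rewrite -subr_eq0 -[_ - _]endoB; apply/eqP.
  (* A power of [x] kills [v - x (y v)] modulo [F k], so 0 is also a Drazin image of this vector. *)
  apply: (uniq (v - x (y v))) => // k; split; last first.
    by have [_ [n Fn]] := yP v k; exists n; rewrite endo0v subr0.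
  by move=> n; exists 0; rewrite endo0v subrr; exact: submod0.
(* The stable kernel makes the exponent independent of [v]. *)
- move=> k; have [n [_ ker]] := fitting_index k.
  by exists n => v; have [_ [m]] := yP v k; exact: ker.
Qed.

End Drazin.

Section CentralizerFiltration.
Variable X : set (endo V).
Local Notation T := (centralizer X).
Implicit Types f g : T.

Lemma centralizerME f g v : (val (f * g) : endo V) v = val f (val g v).
Proof. by []. Qed.

Lemma centralizer_drazin (x : T) : exists y : T,
  y * (x * y) = y /\
  forall k, exists n, forall v, F k ((val x ^+ n) (v - val x (val y v))).
Proof.
have [y [yC yxy Fy]] := drazin_inverse (val x).
have [z zE] : exists z : T, val z = y.
  by apply: centralizer_mk => a Xa; apply: yC; exact: centralizerP.
exists z; rewrite zE; split=> //; apply: val_inj.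
by rewrite !rmorphM /= zE.
Qed.

Lemma centralizer_idempotent (x y : T) : y * (x * y) = y -> x * y * (x * y) = x * y.
Proof. by move=> yxy; rewrite -mulrA yxy. Qed.

(** When [x * y = 0], [x] is nilpotent modulo every [F k], so [1 - x] is injective there. Cancelling
    its powers shows that its Drazin inverse is a right inverse, which thus lies in [T] without a
    limit argument. *)
Lemma centralizer_semipotent : semipotent T.
Proof.
move=> x; have [y [yxy Fy]] := centralizer_drazin x.
have [e0|e0] := pselect (x * y = 0); last first.
  by right; exists y; split=> //; exact: centralizer_idempotent.
left; have [z [zxz Fz]] := centralizer_drazin (1 - x); exists z.
have y0 : y = 0 by rewrite -yxy e0 mulr0.
have inj k w : F k (w - val x w) -> F k w.
  move=> Fw; have [n Fn] := Fy k.
  have Fnw : F k ((val x ^+ n) w).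
    by have := Fn w; rewrite y0 (_ : val x (val (0 : T) w) = 0) ?subr0 //; exact: endo0v.
  suff H m : F k (w - (val x ^+ m) w) by exact: filt_subTR (H n) Fnw.
  elim: m => [|m IH]; first by rewrite subrr; exact: submod0.
  rewrite endoXS -[w in F k (w - _)](subrK (val x w)) -addrA.
  by apply: submodD => //; rewrite -endoB; exact: filt_endo.
apply: val_inj; apply: linear_ext => v; apply/esym/eqP.
rewrite -subr_eq0; apply/eqP; apply: (filt_sep cF) => k.
have [n /(_ v)] := Fz k.
elim: n (v - _) => [//|n IH] w.
by rewrite exprSr endoME => /IH; exact: inj.
Qed.

Section Quotient.
Variables (k : nat) (Q : pzRingType) (q : {rmorphism T -> Q}).
Hypothesis q_surj : surjective q.
Hypothesis q_ker : forall f, q f = 0 <-> forall v, F k (val f v).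

Lemma quotient_eqP f g : q f = q g <-> forall v, F k (val f v - val g v).
Proof.
have -> : (q f = q g) = (q (f - g) = 0).
  by rewrite rmorphB; apply/propext; split=> [->|/eqP]; rewrite ?subrr // subr_eq0 => /eqP.
exact: q_ker.
Qed.

(** For a single [k] the index is a fixed exponent, so a vanishing Drazin idempotent means
    nilpotent, not just topologically nilpotent. *)
Lemma quotient_drazin (z : Q) :
  exists e n, [/\ z * e * (z * e) = z * e & z * e = 0 -> z ^+ n = 0].
Proof.
have [x <-] := q_surj z; have [y [yxy Fy]] := centralizer_drazin x.
have [n Fn] := Fy k; exists (q y), n; split.
  by rewrite -!rmorphM centralizer_idempotent.
rewrite -rmorphM => /q_ker Fxy; rewrite -rmorphXn; apply/q_ker => v.
rewrite rmorphXn /=; apply: filt_subTR (_ : F k ((val x ^+ n) (val x (val y v)))).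
  by rewrite -endoB.
by apply: filt_endo => //; exact: Fxy.
Qed.

Lemma quotient_semipotent : semipotent Q.
Proof.
move=> z; have [e [n [ee en]]] := quotient_drazin z.
have [e0|e0] := pselect (z * e = 0); last by right; exists e.
by left; apply: (@nilpotent_right_quasiregular _ z n); exact: en.
Qed.

Lemma quotient_Jac_nil (z : Q) : Jac_set z -> exists n, z ^+ n = 0.
Proof.
move=> Jz; have [e [n [ee en]]] := quotient_drazin z; exists n; apply: en.
by apply: Jac_idempotent => //; exact: (ridealM e (@right_ideal_Jac Q)).
Qed.

Lemma quotient_idempotent_acc : idempotent_acc Q.
Proof.
move=> e eP; have [f fE] := choice (fun n => q_surj (e n)).
have [n|n v Fv|n v Fv|n nE] := filt_dcc cF (k := k)
  (N_ := fun n => [set v | F k (val (f n) v)]).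
- exact (submodule_preimage (val (f n)) (sF k)).
- exact: filt_endo.
- have /quotient_eqP/(_ v) : q (f n * f n.+1) = q (f n).
    by rewrite rmorphM !fE; have [] := eP n.
  by move=> /filt_subC H; apply: filt_subTR H _; exact: (filt_endo cF (val (f n)) Fv).
exists n; have [ee _ <-] := eP n; rewrite -!fE -rmorphM.
apply/quotient_eqP => v; rewrite centralizerME -endoB.
suff : [set v | F k (val (f n.+1) v)] (v - val (f n) v) by [].
rewrite (nE n.+1) //= endoB.
have /quotient_eqP/(_ v) : q (f n) = q (f n * f n) by rewrite rmorphM fE ee.
by [].
Qed.

Lemma quotient_cover : idempotent_cover Q.
Proof. exact: semipotent_cover quotient_semipotent quotient_idempotent_acc. Qed.

Let I : set T := [set f | Jac_set (q f)].

(** The analogue of [Jac_layer] for the action of [T] on [V / F k], with [I] in place of the radical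
    of the base ring. *)
Fixpoint radical_layer i : set V :=
  if i is i'.+1 then [set v | forall f, I f -> radical_layer i' (val f v)] else F k.

Lemma submodule_radical_layer i : submodule (radical_layer i).
Proof.
elim: i => [|i IH] /=; first exact: sF.
apply: submodP => /=.
- by move=> f _; rewrite endo0v; exact: submod0.
- by move=> u v Zu Zv f If; rewrite endoDv; apply: submodD => //; [exact: Zu|exact: Zv].
- by move=> a u Zu f If; rewrite endoZ; apply: submodZ => //; exact: Zu.
Qed.

Lemma radical_layer_stable i f v : radical_layer i v -> radical_layer i (val f v).
Proof.
case: i => [|i] /=; first exact: (filt_endo cF).
move=> Zv g Ig; rewrite -centralizerME; apply: Zv.
by rewrite /I /= rmorphM; exact: (ridealM _ (@right_ideal_Jac Q)).
Qed.

Lemma radical_layerS i : radical_layer i `<=` radical_layer i.+1.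
Proof. by move=> v Zv f _; exact: radical_layer_stable. Qed.

Lemma radical_layer_prod (s : seq T) i v : (forall f, f \in s -> I f) ->
  radical_layer (i + size s) v -> radical_layer i (val (\prod_(f <- s) f) v).
Proof.
elim: s i v => [|f s IH] i v sI; first by rewrite addn0 big_nil.
rewrite /= -addSnnS big_cons => /IH H.
have /H/(_ f) : forall g, g \in s -> I g.
  by move=> g gs; apply: sI; rewrite in_cons gs orbT.
by apply; apply: sI; rewrite mem_head.
Qed.

(* Otherwise the layers stabilize at some [Z] and there is a stable [U] over [Z]
   with no stable submodule in between.  If [x] in [I] has minimal nonzero image in
   [U / Z], some [x * t * x] has the same image, so [x * t] is not nilpotent. *)
Lemma radical_layer_all : exists n, forall v, radical_layer n v.
Proof.
have sZ := submodule_radical_layer.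
have FZ i : F k `<=` radical_layer i.
  by elim: i => // i IH v /IH; exact: radical_layerS.
have [n nE] := filt_acc cF sZ FZ radical_layerS.
set Z := radical_layer n in nE.
have ZS v : (forall f, I f -> Z (val f v)) -> Z v.
  by move=> H; have : radical_layer n.+1 v := H; rewrite (nE n.+1 (leqnSn n)).
have ZT f v : Z v -> Z (val f v) by exact: radical_layer_stable.
exists n; apply: contrapT => /existsNP[v0 Zv0].
pose P U := [/\ submodule U, forall f v, U v -> U (val f v),
  Z `<=` U & exists2 u, U u & ~ Z u].
have [||U [[sU UT ZU [u0 Uu0 Zu0]] _ Umin]] :=
  @dcc_min _ _ _ P setT (filt_dcc cF (k := k)).
- by move=> N [sN _ ZN _]; split=> //; exact: subset_trans (FZ n) ZN.
- by split=> //; [exact: submodP|exists v0].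
(* The images are enlarged by [Z] so that they lie above [F k], where descending chains stop. *)
pose P' W := exists2 x, I x &
  W = sumset (val x @` U) Z /\ exists2 u, U u & ~ Z (val x u).
have [x1 [Ix1 x1P]] : exists x, I x /\ exists2 u, U u & ~ Z (val x u).
  apply: contrapT => no; apply: Zu0; apply: ZS => f If; apply: contrapT => Zfu.
  by apply: no; exists f; split=> //; exists u0.
have [|| W [[x Ix [WE [u Uu Zxu]]] _ Wmin]] :=
  @dcc_min _ _ _ P' (sumset (val x1 @` U) Z) (filt_dcc cF (k := k)).
- move=> _ [x Ix [-> _]]; split.
    exact: submodule_sumset (submodule_image _ sU) (sZ n).
  move=> v /(FZ n) Zv; exists 0, v; split=> //; last by rewrite add0r.
  by exists 0; [exact: submod0|exact: endo0v].
- by exists x1.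
have [t Zxt] : exists t : T, ~ Z (val x (val t (val x u))).
  apply: contrapT => no.
  (* [U1] is stable, lies over [Z] and contains [val x u], so minimality of [U] makes it all of [U];
     then [t = 1] puts [val x u] into [Z]. *)
  pose U1 := [set w | U w /\ forall t : T, Z (val x (val t w))].
  have U1E : U1 = U.
    apply: Umin; last by move=> w [].
    split.
    - apply: submodP.
      + by split=> [|t]; [exact: submod0|rewrite !endo0v; exact: (submod0 (sZ n))].
      + move=> w w' [Uw Zw] [Uw' Zw']; split=> [|t]; first exact: submodD.
        by rewrite !endoDv; exact: (submodD (sZ n) (Zw t) (Zw' t)).
      + move=> a w [Uw Zw]; split=> [|t]; first exact: submodZ.
        by rewrite !endoZ; exact: (submodZ _ (sZ n) (Zw t)).
    - move=> f w [Uw Zw]; split=> [|t]; first exact: UT.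
      by have := Zw (t * f).
    - by move=> w Zw; split=> [|t]; [exact: ZU|do 2!apply: (ZT)].
    - exists (val x u) => //; split=> [|t]; first exact: UT.
      by apply: contrapT => Zt; apply: no; exists t.
  have : U1 u by rewrite U1E.
  by move=> [_ /(_ 1)].
have Ixtx : I (x * t * x).
  by rewrite /I /= !rmorphM; do 2!apply: (ridealM _ (@right_ideal_Jac Q)).
have WE' : sumset (val (x * t * x) @` U) Z = W.
  apply: Wmin; first by exists (x * t * x) => //; split=> //; exists u.
  move=> _ [_ [z [[w Uw <-] Zz ->]]]; rewrite WE; exists (val x (val t (val x w))), z.
  by split=> //; exists (val t (val x w)) => //; do 2!apply: (UT).
have [m xtm] : exists m, q (x * t) ^+ m = 0.
  by apply: quotient_Jac_nil; rewrite rmorphM; exact: (ridealM _ (@right_ideal_Jac Q)).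
have step w : U w -> exists2 w', U w' & Z (val x w - val (x * t) (val x w')).
  move=> Uw; have : W (val x w).
    rewrite WE; exists (val x w), 0.
    by split; [by exists w|exact: (submod0 (sZ n))|rewrite addr0].
  rewrite -WE' => -[_ [z [[w' Uw' <-] Zz ->]]]; exists w' => //.
  by rewrite [_ + z]addrC addrK.
(* Iterating the equality of images writes [x u] modulo [Z] as [(x t)^j x w'] for every [j]; for
   [j = m] this lies in [F k]. *)
have steps j : exists2 w', U w' & Z (val x u - val ((x * t) ^+ j) (val x w')).
  elim: j => [|j [w Uw Zw]]; first exists u => //.
    by rewrite subrr; exact: (submod0 (sZ n)).
  have [w' Uw' Zw'] := step w Uw; exists w' => //.
  rewrite exprSr centralizerME.
  rewrite -[val x u](subrK (val ((x * t) ^+ j) (val x w))) -addrA.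
  by apply: (submodD (sZ n)) => //; rewrite -endoB; exact: ZT.
have [w Uw Zw] := steps m; apply: Zxu.
apply: (submodTR (sZ n) Zw); apply: (FZ n).
by have /q_ker : q ((x * t) ^+ m) = 0 by rewrite rmorphXn.
Qed.

Lemma quotient_Jac_nilpotent : exists n, nilpotent_products (@Jac_set Q) [set 0] n.
Proof.
have [n Zn] := radical_layer_all; exists n => s sn sJ.
have [h hE] := choice q_surj.
have -> : \prod_(x <- s) x = q (\prod_(f <- map h s) f).
  by rewrite rmorph_prod big_map; apply: eq_bigr => x _; rewrite hE.
apply/q_ker => v; apply: (@radical_layer_prod _ 0).
  by move=> _ /mapP[x /sJ Jx ->]; rewrite /I /= hE.
by rewrite size_map sn; exact: Zn.
Qed.

End Quotient.
End CentralizerFiltration.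
End CompleteFiltration.

(** * Finitely presented modules over complete rings *)

Section Mulmod.
Variables (R : pzRingType) (J : set R).
Hypothesis iJ : two_sided_ideal J.

Lemma ideal_sum (I : eqType) (s : seq I) (F : I -> R) :
  (forall i, i \in s -> J (F i)) -> J (\sum_(i <- s) F i).
Proof.
move=> JF; rewrite big_seq; apply: (big_ind J) => //; first by case: iJ.
by move=> x y; exact: idealD.
Qed.

Lemma submodule_mulmod (V : lmodType R^c) : submodule (mulmod V J).
Proof.
apply: submodP; first exact: mulmod0.
- move=> _ _ [s sJ ->] [t tJ ->]; exists (s ++ t); last by rewrite big_cat.
  by move=> x; rewrite mem_cat => /orP[/sJ|/tJ].
- move=> a _ [s sJ ->]; exists [seq (x.1, (x.2 * (a : R) : R)) | x <- s].
    by move=> _ /mapP[x /sJ Jx ->] /=; have [_ _ _] := iJ; apply.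
  by rewrite big_map scaler_sumr; apply: eq_bigr => x _; rewrite scalerA.
Qed.

Lemma mulmod_lift (V W : lmodType R^c) (g : {linear V -> W}) w : surjective g ->
  mulmod W J w -> exists2 v, mulmod V J v & g v = w.
Proof.
move=> /choice[h hK] [s sJ ->].
exists (\sum_(x <- s) x.2 *: h x.1).
  exists [seq (h x.1, x.2) | x <- s]; last by rewrite big_map.
  by move=> _ /mapP[x /sJ Jx ->].
by rewrite linear_sum; apply: eq_bigr => x _; rewrite linearZ /= hK.
Qed.

Lemma mulmod_row n (v : 'rV[R^c]_n) : mulmod 'rV[R^c]_n J v <-> forall i, J (v 0 i).
Proof.
split=> [[s sJ ->] i|Jv].
  rewrite summxE; apply: ideal_sum => x /sJ Jx; rewrite mxE.
  by have [_ _ Jl _] := iJ; exact: Jl.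
exists [seq (delta_mx 0 i, v 0 i) | i <- enum 'I_n].
  by move=> _ /mapP[i _ ->]; exact: Jv.
by rewrite big_map big_enum [LHS]row_sum_delta.
Qed.

End Mulmod.

Section RowChains.
Variables (R Q : pzRingType) (q : {rmorphism R -> Q}) (J : set R) (n : nat).
Hypothesis iJ : two_sided_ideal J.
Hypothesis q_surj : surjective q.
Hypothesis q_ker : forall x, q x = 0 <-> J x.
Hypothesis Qart : right_artinian Q.

Let F := mulmod 'rV[R^c]_n J.

(** Only semilinear along [q], so chains of submodules are transported by hand. *)
Let qrow (v : 'rV[R^c]_n) : 'rV[Q^c]_n := \row_i q (v 0 i).

Let image_submodule (N : set 'rV[R^c]_n) : submodule N -> submodule (qrow @` N).
Proof.
move=> sN; apply: submodP.
- by exists 0; [exact: submod0|apply/rowP => i; rewrite !mxE rmorph0].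
- move=> _ _ [v Nv <-] [w Nw <-]; exists (v + w); first exact: submodD.
  by apply/rowP => i; rewrite !mxE rmorphD.
- move=> b _ [v Nv <-]; have [a ab] := q_surj b.
  exists ((a : R^c) *: v); first exact: submodZ.
  by apply/rowP => i; rewrite !mxE -ab; exact: (rmorphM q (v 0 i) a).
Qed.

Let image_inj (N N' : set 'rV[R^c]_n) : submodule N -> F `<=` N ->
  qrow @` N' `<=` qrow @` N -> N' `<=` N.
Proof.
move=> sN FN sub v N'v; have [w Nw /rowP wv] : (qrow @` N) (qrow v).
  by apply: sub; exists v.
apply: submodTR (Nw) => //; apply: FN; apply/mulmod_row => // i; apply/q_ker.
by have := wv i; rewrite !mxE rmorphB => ->; rewrite subrr.
Qed.

Lemma row_artinian_conv : artinian_module ('rV[Q^c]_n : lmodType Q^c).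
Proof. exact: row_artinian. Qed.

Lemma row_dcc : dcc_above F.
Proof.
move=> N sN FN dN.
have [||m mP] := row_artinian_conv (N_ := fun i => qrow @` N i).
- by move=> i; exact: image_submodule.
- by move=> i _ [v Nv <-]; exists v => //; exact: dN.
exists m => k mk; apply/seteqP; split.
  by apply: image_inj => //; rewrite mP.
by apply: image_inj => //; rewrite (mP k).
Qed.

Lemma row_acc : acc_above F.
Proof.
have acc : @acc_above Q^c 'rV[Q^c]_n [set 0].
  apply: right_artinian_acc => //; last exact: artinian_dcc row_artinian_conv.
  by apply: submodP => // [x y -> ->|a x ->]; rewrite ?addr0 ?scaler0.
move=> N sN FN iN.
have [|||m mP] := acc (fun i => qrow @` N i).
- by move=> i; exact: image_submodule.
- by move=> i _ ->; exact: (submod0 (image_submodule (sN i))).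
- by move=> i _ [v Nv <-]; exists v => //; exact: iN.
exists m => k mk; apply/seteqP; split.
  by apply: image_inj => //; rewrite mP.
by apply: image_inj => //; rewrite (mP k).
Qed.

End RowChains.

Section ChainsSurjective.
Variables (A : pzRingType) (V W : lmodType A) (g : {linear V -> W}).
Variables (F : set V) (F' : set W).
Hypothesis g_surj : surjective g.
Hypothesis FF' : forall v, F v -> F' (g v).

Let preimage_inj (N N' : set W) : g @^-1` N `<=` g @^-1` N' -> N `<=` N'.
Proof. by move=> sub w; have [v <-] := g_surj w; exact: sub. Qed.

Lemma dcc_above_surj : dcc_above F -> dcc_above F'.
Proof.
move=> dF N sN FN dN; have [|||m mP] := dF (fun i => g @^-1` N i).
- by move=> i; exact: submodule_preimage.
- by move=> i v /FF' /(FN i).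
- by move=> i v; exact: dN.
by exists m => k mk; apply/seteqP; split; apply: preimage_inj; rewrite mP.
Qed.

Lemma acc_above_surj : acc_above F -> acc_above F'.
Proof.
move=> dF N sN FN dN; have [|||m mP] := dF (fun i => g @^-1` N i).
- by move=> i; exact: submodule_preimage.
- by move=> i v /FF' /(FN i).
- by move=> i v; exact: dN.
by exists m => k mk; apply/seteqP; split; apply: preimage_inj; rewrite mP.
Qed.

End ChainsSurjective.

(* Mittag-Leffler: a decreasing sequence of nonempty cosets of submodules
   [D k >= F k] of a complete module has a common point. *)
Lemma mittag_leffler (A : pzRingType) (V : lmodType A) (F D S : nat -> set V) :
  complete_filtration F -> (forall k, submodule (D k)) -> (forall k, F k `<=` D k) ->
  (forall k, D k.+1 `<=` D k) -> (forall k, S k.+1 `<=` S k) ->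
  (forall k, exists s, S k s) ->
  (forall k s s', S k s -> S k s' -> D k (s - s')) ->
  (forall k s d, S k s -> D k d -> S k (s + d)) ->
  exists w, forall k, S k w.
Proof.
move=> cF sD FD dD dS Sne SD DS; have sF := filt_sub cF.
(* The points visible modulo [F k] from every [S l]. Since [D l + F k] stops descending, a late
   [S L] consists of such points, and a point of [Sinf k] can be corrected within [F k] to one of
   [Sinf k.+1]. *)
pose Sinf k : set V := [set w | forall l, exists s, S l s /\ F k (w - s)].
have stable k : exists L, S L `<=` Sinf k.
  have [l|l v Fv|l v|L LP] := filt_dcc cF (k := k) (N_ := fun l => sumset (D l) (F k)).
  - exact: submodule_sumset.
  - by exists 0, v; split=> //; [exact: submod0|rewrite add0r].
  - by move=> [d [f [/dD Dd Ff ->]]]; exists d, f.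
  exists L => s Ss l; have [lL|Ll] := leqP l L.
    exists s; split; first exact: (decreasing_le dS lL).
    by rewrite subrr; exact: submod0.
  have [t St] := Sne l.
  have : sumset (D L) (F k) (s - t).
    exists (s - t), 0; split; [|exact: submod0|by rewrite addr0].
    by apply: SD => //; exact: (decreasing_le dS (ltnW Ll)).
  rewrite -(LP l (ltnW Ll)) => -[d [f [Dd Ff stE]]].
  by exists (t + d); split; [exact: DS|rewrite opprD addrA stE addrC addKr].
have step k w : exists w', Sinf k w -> Sinf k.+1 w' /\ F k (w' - w).
  have [Sw|] := pselect (Sinf k w); last by exists 0.
  have [L LS] := stable k.+1; have [s [Ss Fs]] := Sw L.
  exists s => _; split; first exact: LS.
  by apply: filt_subC Fs; exact: cF.
have [L0 L0S] := stable 0%N; have [s0 Ss0] := Sne L0.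
have [next nextP] := choice (fun p : nat * V => step p.1 p.2).
pose w := fix w k := if k is k'.+1 then next (k', w k') else s0.
have wP k : Sinf k (w k).
  by elim: k => [|k IH]; [exact: L0S|have [] := nextP (k, w k) IH].
have [k|v vP] := filt_complete cF (v := w).
  by have [] := nextP (k, w k) (wP k).
exists v => k; have [s [Ss Fs]] := wP k k.
rewrite -[v](subrK s) addrC; apply: DS => //; apply: FD.
by rewrite -[v - s](subrKA (w k)); exact: (submodD (sF k) (vP k) Fs).
Qed.

(** What remains of the topological hypotheses on [R]. The quotients are given up to isomorphism, so
    that the rings of the inverse system can serve directly. *)
Record artinian_completion (R : pzRingType) (J : nat -> set R) : Prop :=
  ArtinianCompletion {
  ac_ideal : forall k, two_sided_ideal (J k);
  ac_dec : forall k, J k.+1 `<=` J k;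
  ac_sep : forall x, (forall k, J k x) -> x = 0;
  ac_complete : forall x : nat -> R, (forall k, J k (x k.+1 - x k)) ->
    exists y, forall k, J k (y - x k);
  ac_artinian : forall k, exists (Q : pzRingType) (q : {rmorphism R -> Q}),
    [/\ surjective q, forall x, q x = 0 <-> J k x & right_artinian Q] }.

Section Completion.
Variables (R : pzRingType) (J : nat -> set R).
Hypothesis aJ : artinian_completion J.
Let iJ k := ac_ideal aJ k.

Lemma row_filtration n : complete_filtration (fun k => mulmod 'rV[R^c]_n (J k)).
Proof.
split.
- by move=> k; exact: submodule_mulmod.
- by move=> k; exact: (@mulmodS R^c _ _ _ (ac_dec aJ (k := k))).
- by move=> f k v; exact: (mulmod_linear f).
- by move=> k; have [Q [q [qs qk Qart]]] := ac_artinian aJ k; exact: row_dcc qs qk Qart.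
- by move=> k; have [Q [q [qs qk Qart]]] := ac_artinian aJ k; exact: row_acc qs qk Qart.
- move=> v Fv; apply/rowP => i; rewrite mxE; apply: (ac_sep aJ) => k.
  exact: ((mulmod_row (iJ k) v).1 (Fv k) i).
- move=> v Fv.
  have /choice[w wP] i : exists y : R, forall k, J k (y - v k 0 i).
    apply: (ac_complete aJ) => k.
    by have := (mulmod_row (iJ k) _).1 (Fv k) i; rewrite !mxE.
  by exists (\row_i w i) => k; apply/mulmod_row => // i; rewrite !mxE; exact: wP.
Qed.

Variable M : lmodType R^c.
Hypothesis fpM : finitely_presented M.

(** Chain conditions and completeness descend along [g]. Separation is the delicate point: it says
    that the range of [f] is closed. *)
Lemma fp_filtration : complete_filtration (fun k => mulmod M (J k)).
Proof.
have [m [n [f [g [gs ex]]]]] := fpM.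
have cn := row_filtration n; have cm := row_filtration m.
split.
- by move=> k; exact: submodule_mulmod.
- by move=> k; exact: (@mulmodS R^c _ _ _ (ac_dec aJ (k := k))).
- by move=> h k v; exact: (mulmod_linear h).
- by move=> k; apply: (dcc_above_surj gs) (filt_dcc cn (k := k)); exact: mulmod_linear.
- by move=> k; apply: (acc_above_surj gs) (filt_acc cn (k := k)); exact: mulmod_linear.
- move=> v0; have [v <-] := gs v0 => Fv {v0}.
  (* The solutions [w] of [f w = v] modulo [J k] form a coset of the preimage of the [k]-th term
     under [f]; a common solution puts [v] in the kernel of [g]. *)
  have [k|k||k|k|k s s'|k s d|w Sw] := mittag_leffler (S := fun k =>
     [set w | mulmod 'rV[R^c]_n (J k) (v - f w)]) (D := fun k =>
     f @^-1` mulmod 'rV[R^c]_n (J k)) cm.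
  + exact: (submodule_preimage f (submodule_mulmod (iJ k) _)).
  + by move=> w; exact: mulmod_linear.
  + by move=> k w; apply: (filt_dec cn).
  + by move=> w; apply: (filt_dec cn).
  + have [u Fu gu] := mulmod_lift gs (Fv k).
    have [w fw] : exists w, f w = v - u by apply/ex; rewrite linearB gu subrr.
    by exists w; rewrite /= fw opprB addrC subrK.
  + move=> /= Ss Ss'; have -> : f (s - s') = (v - f s') - (v - f s).
      by rewrite linearB opprB [RHS]addrC subrKA.
    by apply: submodB => //; exact: filt_sub cn k.
  + move=> /= Ss Dd; rewrite linearD opprD addrA.
    by apply: submodB => //; exact: filt_sub cn k.
  apply/ex; exists w; apply/eqP; rewrite eq_sym -subr_eq0; apply/eqP.
  by apply: (filt_sep cn) => k; exact: Sw.
- move=> v Fv.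
  have [v0 gv0] := gs (v 0%N).
  (* The differences are lifted, not the terms, so that the lifted sequence converges. *)
  have /choice[c cP] k : exists c, mulmod 'rV[R^c]_n (J k) c /\ g c = v k.+1 - v k.
    by have [c Fc gc] := mulmod_lift gs (Fv k); exists c.
  pose u k := v0 + \sum_(i < k) c i.
  have gu k : g (u k) = v k.
    rewrite linearD linear_sum gv0; elim: k => [|k IH]; first by rewrite big_ord0 addr0.
    by rewrite big_ord_recr /= addrA IH (cP k).2 addrC subrK.
  have [k|w wP] := filt_complete cn (v := u).
    rewrite /u big_ord_recr /= addrA [_ + c k]addrC addrK; exact: (cP k).1.
  by exists (g w) => k; rewrite -gu -linearB; exact: mulmod_linear.
Qed.

End Completion.

Lemma rmorphism_mk (R S : pzRingType) (f : R -> S) : zmod_morphism f ->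
  monoid_morphism f -> exists g : {rmorphism R -> S}, forall x, g x = f x.
Proof.
move=> fB fM.
pose fBM := GRing.isZmodMorphism.Build _ _ f fB.
pose fMM := GRing.isMonoidMorphism.Build _ _ f fM.
by pose g : {rmorphism R -> S} := HB.pack f fBM fMM; exists g.
Qed.

(** * Inverse limits *)

Section KernelBase.
Variable X : invSystem.

Definition proj_kernel i : set (invlim X) := [set x | invlim_proj i x = 0].

Lemma proj_kernel_ideal i : two_sided_ideal (proj_kernel i).
Proof.
rewrite /proj_kernel; split=> //=.
- move=> x y /= xi yi; rewrite -[LHS]/(invlim_proj i x - invlim_proj i y).
  by rewrite xi yi subrr.
- move=> a x /= xi; rewrite -[LHS]/(invlim_proj i a * invlim_proj i x).
  by rewrite xi mulr0.
- move=> a x /= xi; rewrite -[LHS]/(invlim_proj i x * invlim_proj i a).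
  by rewrite xi mul0r.
Qed.

Lemma proj_kernelS i j : (i <= j)%O -> proj_kernel j `<=` proj_kernel i.
Proof. by move=> ij x /= xj; rewrite /proj_kernel /= -(invlim_projP x ij) xj rmorph0. Qed.

Definition kernel_base_set : set (set (invlim X)) :=
  [set A | exists i, A = proj_kernel i].

Lemma kernel_base_nonempty : kernel_base_set !=set0.
Proof. by have [i] := inv_idx_nonempty X; exists (proj_kernel i), i. Qed.

Lemma kernel_base_directed A B : kernel_base_set A -> kernel_base_set B ->
  exists2 C, kernel_base_set C & C `<=` A `&` B.
Proof.
move=> [i ->] [j ->]; have [k ik jk] := inv_idx_directed i j.
exists (proj_kernel k); first by exists k.
by move=> x xk; split; apply: proj_kernelS xk.
Qed.

Lemma kernel_base_ideal A : kernel_base_set A -> two_sided_ideal A.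
Proof. by move=> [i ->]; exact: proj_kernel_ideal. Qed.

Definition kernel_base : idealBase (invlim X) :=
  IdealBase kernel_base_nonempty kernel_base_directed kernel_base_ideal.

(** By the universal property of the limit topology, the identity is continuous from the topology of
    the kernels; the product topology need not be unfolded. *)
Lemma nbhs0_invlim (U : set (invlim X)) : nbhs (0 : invlim X) U ->
  exists i, proj_kernel i `<=` U.
Proof.
move=> U0; have cid : continuous (fun t : linear_topology kernel_base => t : invlim X).
  apply: continuous_to_invlim => i t W /nbhs_singleton Wt.
  exists (proj_kernel i); first by exists i.
  move=> a /= ai; rewrite /= -[invlim_proj i _]/(invlim_proj i t + invlim_proj i a).
  by rewrite ai addr0.
have [_ [i ->] iU] := cid 0 U U0.
by exists i => x /iU; rewrite add0r.
Qed.

End KernelBase.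

Section FromTopology.
Variables (R : topPzRingType) (X : invSystem) (phi : {rmorphism R -> invlim X}).
Hypothesis phi_iso : top_ring_iso phi.

Let ker i : set R := [set r | invlim_proj i (phi r) = 0].

Lemma kernel_ideal i : two_sided_ideal (ker i).
Proof.
have [K0 KB Kl Kr] := proj_kernel_ideal i; split.
- by rewrite /ker /= rmorph0.
- by move=> x y xi yi; rewrite /ker /= rmorphB; exact: KB.
- by move=> a x xi; rewrite /ker /= rmorphM; exact: Kl.
- by move=> a x xi; rewrite /ker /= rmorphM; exact: Kr.
Qed.

Lemma kernel_open i : open (ker i).
Proof.
have [psi [_ _ cphi _]] := phi_iso.
rewrite openE => x xi.
apply: (cphi x [set y | invlim_proj i y = 0]).
apply: (@invlim_proj_continuous X i (phi x) [set 0]).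
by rewrite xi; exact: discrete_set1.
Qed.

Lemma kernel_cofinal (U : set R) : nbhs (0 : R) U -> exists i, ker i `<=` U.
Proof.
have [psi [phiK psiK _ cpsi]] := phi_iso => U0.
have psi0 : psi 0 = 0 by rewrite -(rmorph0 phi) phiK.
have [|i iU] := @nbhs0_invlim X [set y | U (psi y)].
  by apply: cpsi; rewrite psi0.
by exists i => r ri; rewrite -[r]phiK; exact: iU.
Qed.

End FromTopology.

Lemma countable_nbhs0 (R : topPzRingType) : first_countable R ->
  exists U : nat -> set R, (forall n, nbhs (0 : R) (U n)) /\
    forall W, nbhs (0 : R) W -> exists n, U n `<=` W.
Proof.
move=> [B /countable_injP[f finj] [B0 BW]].
(* At most one member of [B] has the number [n]; if there is none, the set is everything. *)
exists (fun n => [set x | forall W, B W -> f W = n -> W x]); split.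
  move=> n; have [[W [BW' fW]]|no] := pselect (exists W, B W /\ f W = n).
    apply: filterS (B0 _ BW') => x Wx W' BW'' fW'.
    by rewrite (finj W' W) ?inE // fW' fW.
  by apply: filterS (filterT : nbhs (0 : R) setT) => x _ W BW' fW; case: no; exists W.
move=> W /BW[W' BW' W'W]; exists (f W') => x /(_ _ BW' erefl); exact: W'W.
Qed.

Lemma artinian_completion_exists (R : topPzRingType) :
  first_countable R -> strictly_pro_right_artinian R ->
  exists J : nat -> set R, [/\ artinian_completion J, forall k, open (J k) &
    forall U, nbhs (0 : R) U -> exists k, J k `<=` U].
Proof.
move=> /countable_nbhs0[U [U0 UW]] [X [phi [iso Xart phis]]].
pose ker i : set R := [set r | invlim_proj i (phi r) = 0].
have /choice[i iP] n : exists i, ker i `<=` U n by exact: kernel_cofinal.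
have /choice[next nextP] (p : inv_idx X * inv_idx X) :
    exists k, (p.1 <= k)%O /\ (p.2 <= k)%O.
  by have [k] := inv_idx_directed p.1 p.2; exists k.
(* An increasing sequence of indices above the [i n], which makes the kernels both decreasing and
   cofinal. *)
pose j := fix j n := if n is n'.+1 then next (j n', i n) else i 0%N.
have kerS a b : (a <= b)%O -> ker b `<=` ker a.
  by move=> ab r; exact: proj_kernelS.
have ji n : (i n <= j n)%O by case: n => [//|n] /=; have [] := nextP (j n, i n.+1).
have jS n : (j n <= j n.+1)%O by rewrite /=; have [] := nextP (j n, i n.+1).
pose J n := ker (j n).
have dJ n : J n.+1 `<=` J n by exact: kerS.
have iJ n : two_sided_ideal (J n) by exact: (kernel_ideal phi).
have leJ := decreasing_le dJ.
have cof W : nbhs (0 : R) W -> exists n, J n `<=` W.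
  move=> /UW[n nW]; exists n; apply: subset_trans nW.
  by apply: subset_trans (iP n); exact: kerS.
have kerO a : open (ker a) by exact: (kernel_open iso).
have cofker a : exists n, J n `<=` ker a.
  by apply: cof; apply: open_nbhs_nbhs; split=> //; rewrite /ker /= rmorph0.
exists J; split=> [|k|//]; last exact: kerO.
split=> //.
- move=> x Jx; have [psi [phiK _ _ _]] := iso.
  rewrite -[x]phiK -[0]phiK; congr (psi _); apply: invlimP => a.
  by rewrite rmorph0; have [n] := cofker a; apply.
- move=> x Jx; have [psi [phiK psiK _ _]] := iso.
  have Jle n m : (n <= m)%N -> J n (x m - x n).
    move=> /subnK <-; elim: (m - n)%N => [|d IH].
      by rewrite subrr; have [] := iJ n.
    rewrite addSn -[_ - x n](subrKA (x (d + n)%N)); apply: idealD => //.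
    by apply: leJ (Jx _); rewrite leq_addl.
  have /choice[n nP] := cofker.
  (* From [n a] on the differences lie in [ker a], so coordinate [a] is constant; the limit collects
     these values. *)
  have stab a m : (n a <= m)%N ->
      invlim_proj a (phi (x m)) = invlim_proj a (phi (x (n a))).
    move=> /Jle/(nP a); rewrite /ker /= rmorphB => /eqP.
    rewrite -[invlim_proj a _]/(invlim_proj a (phi (x m)) -
      invlim_proj a (phi (x (n a)))).
    by rewrite subr_eq0 => /eqP.
  pose y : invlim X := @invlim_mk X
    (fun a => invlim_proj a (phi (x (n a)))) (fun a b ab =>
    let m := maxn (n a) (n b) in
    etrans (congr1 (inv_map ab) (esym (stab b m (leq_maxr _ _))))
     (etrans (invlim_projP _ ab) (stab a m (leq_maxl _ _)))).
  exists (psi y) => k.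
  rewrite /J /ker /= rmorphB psiK.
  rewrite -[invlim_proj _ _]/(invlim_proj (j k) (phi (x (n (j k)))) -
    invlim_proj (j k) (phi (x k))).
  rewrite -(stab (j k) (maxn (n (j k)) k) (leq_maxl _ _)).
  have := Jle k (maxn (n (j k)) k) (leq_maxr _ _).
  by rewrite /J /ker /= rmorphB.
- move=> k; have [||q qE] := @rmorphism_mk R (X (j k))
    (fun r => invlim_proj (j k) (phi r)).
  + by move=> a b; rewrite rmorphB.
  + by split=> [|a b]; rewrite ?rmorph1 ?rmorphM.
  exists (X (j k)), q; split=> // [y|x].
    by have [r <-] := phis (j k) y; exists r; rewrite qE.
  by rewrite qE.
Qed.

Lemma quotient_lift (T Q S : pzRingType) (q : {rmorphism T -> Q})
    (r : {rmorphism T -> S}) :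
  surjective q -> (forall x, q x = 0 -> r x = 0) ->
  exists h : {rmorphism Q -> S}, forall x, h (q x) = r x.
Proof.
move=> qs qr; have [s sK] := choice qs.
have hE x y : q x = q y -> r x = r y.
  move=> /eqP; rewrite -subr_eq0 -rmorphB => /eqP/qr/eqP.
  by rewrite rmorphB subr_eq0 => /eqP.
have hq x : r (s (q x)) = r x by apply: hE; rewrite sK.
have [||h hh] := @rmorphism_mk Q S (r \o s).
- by move=> x y; rewrite /= -rmorphB; apply: hE; rewrite rmorphB !sK.
- split=> [|x y] /=; first by rewrite -(rmorph1 q) hq rmorph1.
  by rewrite -rmorphM; apply: hE; rewrite rmorphM !sK.
by exists h => x; rewrite hh /= hq.
Qed.

Lemma nilpotent_products_image (T Q : pzRingType) (q : {rmorphism T -> Q})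
    (I : set T) (K : set Q) m :
  (forall y, K y -> exists2 x, I x & q x = y) -> nilpotent_products I [set 0] m ->
  nilpotent_products K [set 0] m.
Proof.
move=> KI Im s sm sK.
have /choice[h hP] y : exists x, K y -> I x /\ q x = y.
  have [/KI[x Ix xy]|nK] := pselect (K y); first by exists x.
  by exists 0.
have -> : \prod_(y <- s) y = q (\prod_(x <- map h s) x).
  rewrite rmorph_prod big_map !big_seq; apply: eq_bigr => y /sK Ky.
  by rewrite (hP y Ky).2.
rewrite (Im (map h s)) ?size_map // ?rmorph0 //.
by move=> _ /mapP[y /sK Ky ->]; exact: (hP y Ky).1.
Qed.

(** * Chains of idempotent endomorphisms *)

Section IdempotentChains.
Variables (R : pzRingType) (J : nat -> set R).
Hypothesis aJ : artinian_completion J.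
Let iJ k := ac_ideal aJ k.

Lemma Jac_topologically_nilpotent k : exists m, nilpotent_products (@Jac_set R) (J k) m.
Proof.
have [Q [q [qs qk Qart]]] := ac_artinian aJ k.
have [m Jm] := artinian_Jac_nilpotent Qart; exists m => s sm sJ.
apply/qk; rewrite rmorph_prod -(big_map q xpredT id); apply: Jm.
  by rewrite size_map.
by move=> _ /mapP[x /sJ Jx ->]; exact: Jac_image.
Qed.

(** The colon ideal of [J k] by the [i]-th power of the radical: [i] counts the radical factors on
    the left that suffice to reach [J k]. *)
Fixpoint Jac_colon k i : set R :=
  if i is i'.+1 then [set a | forall n, Jac_set n -> Jac_colon k i' (n * a)] else J k.

Lemma Jac_colon_ideal k i : two_sided_ideal (Jac_colon k i).
Proof.
elim: i => [|i [I0 IB Il Ir]] /=; first exact: iJ.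
split=> /=.
- by move=> n _; rewrite mulr0.
- by move=> x y Ix Iy n Jn; rewrite mulrBr; apply: (IB); [exact: Ix|exact: Iy].
- by move=> a x Ix n Jn; rewrite mulrA; apply: Ix; exact: (ridealM a (@right_ideal_Jac R)).
- by move=> a x Ix n Jn; rewrite mulrA; apply: (Ir); exact: Ix.
Qed.

Lemma Jac_colon_all k m : nilpotent_products (@Jac_set R) (J k) m ->
  forall a, Jac_colon k m a.
Proof.
move=> Jm a; have {Jm} : forall s : seq R, size s = m ->
    (forall x, x \in s -> Jac_set x) ->
    J k (\prod_(x <- s) x * a).
  by move=> s sm sJ; have [_ _ _ Jr] := iJ k; apply: (Jr); exact: Jm.
elim: m a => [a /(_ [::] erefl)|m IH a H n Jn /=].
  by rewrite big_nil mul1r; apply.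
apply: IH => s sm sJ; rewrite mulrA.
have -> : \prod_(x <- s) x * n = \prod_(x <- rcons s n) x.
  by rewrite -cats1 big_cat big_seq1.
apply: H; first by rewrite size_rcons sm.
by move=> x; rewrite mem_rcons in_cons => /orP[/eqP ->|/sJ].
Qed.

Variable M : lmodType R^c.
Hypothesis fpM : finitely_presented M.

(* [p] lifts to a matrix with entries in the radical, whose powers tend to 0. *)
Lemma radical_idempotent (p : endo M) :
  p * p = p -> (forall v, mulmod M (@Jac_set R) (p v)) -> p = 0.
Proof.
move=> pp pJ; have [_ [n [_ [g [gs _]]]]] := fpM.
have iJac := Jac_subproof R.
have /choice[w wP] i : exists w : 'rV[R^c]_n,
    mulmod 'rV[R^c]_n (@Jac_set R) w /\ g w = p (g (delta_mx 0 i)).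
  by have [w Jw gw] := mulmod_lift gs (pJ (g (delta_mx 0 i))); exists w.
pose h (v : 'rV[R^c]_n) := \sum_i v 0 i *: w i.
have hl : linear h.
  move=> a x y; rewrite /h scaler_sumr -big_split /=; apply: eq_bigr => i _.
  by rewrite !mxE scalerDl scalerA.
have [P PE] := endo_mk hl.
have gP v : g (P v) = p (g v).
  rewrite PE [v in RHS]row_sum_delta !linear_sum; apply: eq_bigr => i _.
  by rewrite !linearZ /= (wP i).2.
have gPm m v : (p ^+ m) (g v) = g ((P ^+ m) v).
  by elim: m v => [//|m IH] v; rewrite !endoXS IH gP.
(* In [R] the entries of [P v] are sums of radical entries of the [w l] times entries of [v], so
   each application of [P] supplies one radical factor. *)
have colon k i (v : 'rV[R^c]_n) : (forall j, Jac_colon k i.+1 (v 0 j)) ->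
    forall j, Jac_colon k i ((P v) 0 j).
  move=> Cv j; rewrite PE summxE; apply: (ideal_sum (Jac_colon_ideal k i)) => l _.
  rewrite mxE; apply: Cv; exact: ((mulmod_row iJac _).1 (wP l).1 j).
have colonm k i (v : 'rV[R^c]_n) : (forall j, Jac_colon k i (v 0 j)) ->
    forall j, J k (((P ^+ i) v) 0 j).
  by elim: i v => [//|i IH] v Cv; rewrite exprSr endoME; apply: IH; exact: colon.
have pm m : p ^+ m.+1 = p.
  by elim: m => [|m IH]; rewrite ?expr1 // exprS IH.
apply: linear_ext => x; have [v <-] := gs x.
apply: (filt_sep (fp_filtration aJ fpM)) => k.
have [m Jm] := Jac_topologically_nilpotent k.
rewrite -(pm m) exprSr endoME -gP gPm; apply: mulmod_linear.
apply/(mulmod_row (iJ k)); apply: colonm => j; exact: Jac_colon_all.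
Qed.

Variable X : set (endo M).
Local Notation T := (centralizer X).

(** [M / M Jac(R)] is artinian, so the kernels of the [e i] on it become stationary. The idempotent
    [e i.+1 - e i] then has its range in [M Jac(R)] and vanishes by [radical_idempotent]. *)
Lemma centralizer_idempotent_acc :
  right_artinian (quotient_ring (Jac R)) -> idempotent_acc T.
Proof.
move=> Qart e eP; have [_ [n [_ [g [gs _]]]]] := fpM.
have iJac := Jac_subproof R.
have dJ : dcc_above (mulmod M (@Jac_set R)).
  apply: (dcc_above_surj gs) (row_dcc (q := quotient_proj (Jac R)) (n := n) iJac _ _ Qart).
  - exact: mulmod_linear.
  - exact: quotient_proj_surj.
  - exact: quotient_proj0.
have sJ := submodule_mulmod iJac M.
have [i|i v Jv|i v /= Jv|i iE] := dJ (fun i => [set v | mulmod M (@Jac_set R) (val (e i) v)]).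
- exact: (submodule_preimage (val (e i)) sJ).
- exact: (mulmod_linear (val (e i))).
- by have [_ <- _] := eP i; rewrite centralizerME; exact: (mulmod_linear (val (e i))).
exists i; have [ee ee' e'e] := eP i; have [e'e' _ _] := eP i.+1.
pose p := e i.+1 - e i.
suff p0 : p = 0 by apply/eqP; rewrite -subr_eq0 -/p p0.
apply: val_inj; apply: radical_idempotent.
  rewrite -rmorphM; congr (val _).
  by rewrite /p mulrBl !mulrBr e'e' e'e ee' ee subrr subr0.
move=> v; have -> : val p v = val (e i.+1) (v - val (e i) v).
  have -> : p = e i.+1 - e i.+1 * e i by rewrite e'e.
  by rewrite endoB.
suff : [set v | mulmod M (@Jac_set R) (val (e i.+1) v)] (v - val (e i) v) by [].
rewrite (iE i.+1) //=.
have -> : val (e i) (v - val (e i) v) = 0.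
  by rewrite endoB -centralizerME ee subrr.
exact: mulmod0.
Qed.

Lemma centralizer_cover : right_artinian (quotient_ring (Jac R)) -> idempotent_cover T.
Proof.
move=> Qart; apply: semipotent_cover; last exact: centralizer_idempotent_acc.
exact: (centralizer_semipotent (fp_filtration aJ fpM)).
Qed.

End IdempotentChains.

Lemma right_regular_fp (R : pzRingType) : finitely_presented (right_regular R).
Proof.
pose h (v : 'rV[R^c]_1) : right_regular R := v 0 0.
have hl : linear h by move=> a x y; rewrite /h !mxE.
pose hM := GRing.isLinear.Build _ _ _ _ h hl.
pose g : {linear _ -> _} := HB.pack h hM.
exists 0%N, 1%N, (\0 : {linear 'rV[R^c]_0 -> 'rV[R^c]_1}), g; split.
  by move=> y; exists (const_mx y); rewrite /g /= /h mxE.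
move=> x; split=> [x0|[y <-]]; last exact: (linear0 g).
by exists 0; apply/rowP => i; rewrite ord1 mxE.
Qed.

(** [R] is identified with [End(R_R)], the centralizer of the empty set; the fixed submodules of an
    increasing chain of idempotents increase. *)
Lemma noetherian_cover (R : pzRingType) (J : nat -> set R) :
  artinian_completion J -> right_noetherian R -> idempotent_cover R.
Proof.
move=> aJ Rnoeth.
pose T := @centralizer (endo (right_regular R)) set0.
have Tacc : idempotent_acc T.
  move=> e eP.
  have [i|i v|i iE] := Rnoeth (fun i => [set v | val (e i) v = v]).
  - apply: submodP => /=; first exact: endo0v.
      by move=> x y xE yE; rewrite endoDv xE yE.
    by move=> a x xE; rewrite endoZ xE.
  - by move=> /= <-; rewrite -centralizerME; have [_ _ ->] := eP i.
  exists i; have [_ <- _] := eP i; have [e'e' _ _] := eP i.+1.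
  apply: val_inj; apply: linear_ext => v.
  have : [set v | val (e i.+1) v = v] (val (e i.+1) v) by rewrite /= -centralizerME e'e'.
  by rewrite (iE i.+1).
have Tc : idempotent_cover T.
  apply: semipotent_cover Tacc.
  exact: (centralizer_semipotent (fp_filtration aJ (right_regular_fp R))).
pose u : right_regular R := (1 : R).
have valM (f : T) (r : R) : (val f (r : right_regular R) : R) = (val f u : R) * r.
  have := endoZ (val f) (r : R^c) u.
  by rewrite -[_ *: u]/((1 : R) * r) mul1r.
have [||phi phiE] := @rmorphism_mk T R (fun f => val f u).
- by move=> f g.
- by split=> [//|f g]; rewrite centralizerME valM.
apply: (idempotent_cover_image (f := phi)) Tc => r.
have hl : linear (fun x : right_regular R => (r * (x : R) : R) : right_regular R).
  by move=> a x y; rewrite mulrDr -[a *: x]/((x : R) * (a : R)) mulrA.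
have [h hE] := endo_mk hl.
have [f fE] : exists f : T, val f = h by apply: centralizer_mk => a [].
by exists f; rewrite phiE fE hE mulr1.
Qed.

Lemma cover_semiprimary (T : pzRingType) m : idempotent_cover T ->
  nilpotent_products (@Jac_set T) [set 0] m -> semiprimary T.
Proof.
move=> Tc Jm; split; first by have [] := cover_semiperfect Tc.
exact: (@nilpotent_productsP _ (Jac T) m Jm).
Qed.

(** * Inverse limits from filtrations by ideals *)

Section IdealFiltration.
Variables (E : pzRingType) (b : idealBase E) (B : nat -> set E).
Hypothesis bB : forall k, ideal_base b (B k).
Hypothesis cofB : forall A, ideal_base b A -> exists k, B k `<=` A.
Hypothesis dB : forall k, B k.+1 `<=` B k.
Hypothesis sepB : forall x, (forall k, B k x) -> x = 0.
Hypothesis complB : forall x : nat -> E, (forall k, B k (x k.+1 - x k)) ->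
  exists y, forall k, B k (y - x k).

Let iB k : two_sided_ideal (B k) := ideal_baseP (bB k).
Let I k : ideal E := Ideal (iB k).
Let Q k := quotient_ring (I k).
Hypothesis Qsp : forall k, semiprimary (quotient_ring (Ideal (ideal_baseP (bB k)))).

Lemma ideal_filtration_first_countable : first_countable (linear_topology b).
Proof.
exists [set B k | k in setT].
  apply: sub_countable (countableP (@setT nat)); exact: card_image_le.
split=> [_ [k _ <-]|U [A bA AU]].
  by exists (B k) => // a Ba; rewrite /= add0r.
have [k kA] := cofB bA; exists (B k); first by exists k.
by move=> x /kA/AU; rewrite add0r.
Qed.

Let transition i j : (i <= j)%O ->
  {h : {rmorphism Q j -> Q i} |
    forall x, h (quotient_proj (I j) x) = quotient_proj (I i) x}.
Proof.
move=> ij; apply: cid; apply: quotient_lift; first exact: quotient_proj_surj.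
move=> x /quotient_proj0 Bx; apply/quotient_proj0.
by apply: (decreasing_le dB) Bx; rewrite -leEnat.
Qed.

Let transition_id i (ii : (i <= i)%O) x : sval (transition ii) x = x.
Proof. by have [y <-] := quotient_proj_surj x; rewrite (svalP (transition ii)). Qed.

Let transition_comp i j k (ij : (i <= j)%O) (jk : (j <= k)%O) (ik : (i <= k)%O) x :
  sval (transition ij) (sval (transition jk) x) = sval (transition ik) x.
Proof.
have [y <-] := quotient_proj_surj x.
by rewrite (svalP (transition jk)) (svalP (transition ij)) (svalP (transition ik)).
Qed.

Let directed (i j : nat) : exists2 k, (i <= k)%O & (j <= k)%O.
Proof. by exists (maxn i j); rewrite leEnat ?leq_maxl ?leq_maxr. Qed.

Let S : invSystem := @InvSystem _ nat (inhabits 0%N) directed Q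
  (fun i j ij => sval (transition ij)) transition_id transition_comp.

Lemma ideal_filtration_pro_semiprimary : pro_semiprimary (linear_topology b).
Proof.
pose lim (x : E) : invlim S := @invlim_mk S (fun k => quotient_proj (I k) x)
  (fun i j ij => svalP (transition ij) x).
have [||phi phiE] := @rmorphism_mk (linear_topology b) (invlim S) lim.
- by move=> x y; apply: invlimP => k; rewrite /invlim_proj /= rmorphB.
- by split=> [|x y]; apply: invlimP => k; rewrite /invlim_proj /= ?rmorph1 ?rmorphM.
have projE k x : invlim_proj k (phi x) = quotient_proj (I k) x by rewrite phiE.
have /choice[psi psiK] (x : invlim S) : exists y, phi y = x.
  have /choice[e eE] k := quotient_proj_surj (invlim_proj k x).
  have [k|y yB] := complB (x := e).
    have kk : ((k : inv_idx S) <= k.+1)%O by rewrite leEnat.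
    apply/(@quotient_proj_eq _ (I k)); rewrite eE -(invlim_projP x kk) -eE.
    by rewrite (svalP (transition kk)).
  exists y; apply: invlimP => k; rewrite projE -eE.
  by apply/quotient_proj_eq; exact: yB.
have phi_inj x y : phi x = phi y -> x = y.
  move=> xy; apply/eqP; rewrite -subr_eq0; apply/eqP; apply: sepB => k.
  by apply/(@quotient_proj_eq _ (I k)); rewrite -!projE xy.
exists S, phi; split; last exact: Qsp.
exists psi; split=> [x|//||].
- by apply: phi_inj; rewrite psiK.
- apply: continuous_to_invlim => k x W /nbhs_singleton Wx.
  exists (B k) => // a Ba.
  rewrite /preimage /=; suff -> : phi ((x : E) + a) = phi x + phi a.
    have pa : invlim_proj (k : inv_idx S) (phi a) = 0.
      by rewrite projE; apply/quotient_proj0.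
    rewrite /= -[invlim_proj k _]/(invlim_proj (k : inv_idx S) (phi x) +
      invlim_proj (k : inv_idx S) (phi a)).
    by rewrite pa addr0.
  exact: (rmorphD phi x a).
- move=> x U [A bA AU]; have [k kA] := cofB bA.
  have : nbhs x [set y | invlim_proj (k : inv_idx S) y = invlim_proj (k : inv_idx S) x].
    apply: (@invlim_proj_continuous S k x [set invlim_proj (k : inv_idx S) x]).
    exact: discrete_set1.
  apply: filterS => y /= yx.
  have -> : psi y = (psi x : E) + (psi y - psi x) by rewrite addrC subrK.
  apply: AU; apply: kA; apply/(@quotient_proj_eq _ (I k)).
  by rewrite -!projE !psiK.
Qed.

End IdealFiltration.

Section CentralizerImage.
Variables (A : pzRingType) (V : lmodType A) (F : nat -> set V).
Hypothesis cF : complete_filtration F.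
Variables (X : set (endo V)) (E : pzRingType) (phi : {rmorphism centralizer X -> E}).
Hypothesis phi_surj : surjective phi.
Local Notation T := (centralizer X).

Definition filt_endos k : set T := [set f | forall v, F k ((val f : endo V) v)].

Lemma filt_endos_ideal k : two_sided_ideal (filt_endos k).
Proof.
have sF := filt_sub cF k; split.
- by move=> v; exact: (submod0 sF).
- by move=> f g Ff Fg v; exact: (submodB sF (Ff v) (Fg v)).
- by move=> f g Fg v; exact: (filt_endo cF (val f) (Fg v)).
- by move=> f g Fg v; exact: (Fg (val f v)).
Qed.

(** The limit is taken vector by vector; its uniqueness, from separation, gives linearity and
    commutation with [X]. *)
Lemma filt_endos_complete (s : nat -> T) : (forall k, filt_endos k (s k.+1 - s k)) ->
  exists c, forall k, filt_endos k (c - s k).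
Proof.
move=> sS; have sF := filt_sub cF.
have /choice[h hP] v : exists w, forall k, F k (w - val (s k) v).
  by apply: (filt_complete cF) => k; exact: sS.
have uniq w w' : (forall k, F k (w - w')) -> w = w'.
  by move=> Fw; apply/eqP; rewrite -subr_eq0; apply/eqP; exact: (filt_sep cF).
have hl : linear h.
  move=> a x y; apply: uniq => k.
  rewrite -[_ - _](subrKA (val (s k) (a *: x + y))).
  apply: (submodD (sF k)); first exact: hP.
  apply: (filt_subC cF); rewrite endoDv endoZ opprD addrACA -scalerBr.
  by apply: (submodD (sF k)); [apply: (submodZ _ (sF k))|]; exact: hP.
have [H HE] := endo_mk hl.
have [c cE] : exists c : T, val c = H.
  apply: centralizer_mk => a Xa; apply: linear_ext => v.
  rewrite -[LHS]/(a (H v)) -[RHS]/(H (a v)) !HE; apply: uniq => k.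
  rewrite -[_ - _](subrKA (val (s k) (a v))); apply: (submodD (sF k)); last first.
    by apply: (filt_subC cF); exact: hP.
  rewrite -endoME -(centralizerP (s k) Xa) endoME -endoB.
  by apply: (filt_endo cF); exact: hP.
exists c => k v.
by suff : F k (val c v - val (s k) v) by []; rewrite cE HE; exact: hP.
Qed.

Let B k := phi @` filt_endos k.

(** This ring is an image of the quotient of [T] that acts on [V / F k]. Semiperfectness passes
    along as [idempotent_cover], nilpotency of the radical by [Jac_image_cover]. *)
Lemma centralizer_image_semiprimary k (iB : two_sided_ideal (B k)) :
  semiprimary (quotient_ring (Ideal iB)).
Proof.
pose I := Ideal (filt_endos_ideal k).
have qker f : quotient_proj I f = 0 <-> forall v, F k (val f v).
  exact: quotient_proj0.
have qs := @quotient_proj_surj _ I.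
have Qc := quotient_cover cF qs qker.
have [m Jm] := quotient_Jac_nilpotent cF qs qker.
have [r rE] : exists r : {rmorphism T -> quotient_ring (Ideal iB)},
    forall f, r f = quotient_proj (Ideal iB) (phi f).
  apply: rmorphism_mk => [f g|]; first by rewrite !rmorphB.
  by split=> [|f g]; rewrite ?rmorph1 ?rmorphM.
have [h hE] : exists h : {rmorphism quotient_ring I -> quotient_ring (Ideal iB)},
    forall f, h (quotient_proj I f) = r f.
  apply: quotient_lift => // f /qker Ff; rewrite rE; apply/quotient_proj0.
  by exists f.
have hs : surjective h.
  move=> y; have [e <-] := quotient_proj_surj y; have [f <-] := phi_surj e.
  by exists (quotient_proj I f); rewrite hE rE.
apply: (@cover_semiprimary _ m); first exact: idempotent_cover_image hs Qc.
apply: nilpotent_products_image Jm => y Jy.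
exact: (Jac_image_cover hs Qc Jy).
Qed.

Theorem centralizer_image_pro_semiprimary (b : idealBase E) :
  (forall k, ideal_base b (B k)) ->
  (forall U, ideal_base b U -> exists k, B k `<=` U) ->
  (forall x, (forall k, B k x) -> x = 0) ->
  pro_semiprimary (linear_topology b) /\ first_countable (linear_topology b).
Proof.
move=> bB cofB sepB; split; last exact: (ideal_filtration_first_countable bB cofB).
apply: (ideal_filtration_pro_semiprimary (bB := bB)) => //.
- by move=> k _ [f Ff <-]; exists f => // v; exact: (filt_dec cF (Ff v)).
- move=> x Bx.
  have [f0 f0E] := phi_surj (x 0%N).
  (* The differences are lifted into [filt_endos k], so that their partial sums converge in the
     centralizer. *)
  have /choice[c cP] k : exists c, filt_endos k c /\ phi c = x k.+1 - x k.
    by have [c Fc cE] := Bx k; exists c.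
  pose s k := f0 + \sum_(i < k) c i.
  have sE k : phi (s k) = x k.
    rewrite rmorphD rmorph_sum f0E; elim: k => [|k IH]; first by rewrite big_ord0 addr0.
    by rewrite big_ord_recr /= addrA IH (cP k).2 addrC subrK.
  have [k|f fP] := @filt_endos_complete s.
    by rewrite /s big_ord_recr /= addrA [_ + c k]addrC addrK; exact: (cP k).1.
  by exists (phi f) => k; rewrite -sE -rmorphB; exists (f - s k).
- by move=> k; exact: centralizer_image_semiprimary.
Qed.

End CentralizerImage.

(** * The topology of a presentation *)

(** Projectivity lifts along surjections only, so [d1] is corestricted to the kernel of [d0]. *)
Lemma exact_lift (A : pzRingType) (Q B C D : lmodType A) (d1 : {linear B -> C})
    (d0 : {linear C -> D}) (h : {linear Q -> C}) : projective Q ->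
  (forall x, d0 x = 0 <-> exists y, d1 y = x) -> (forall x, d0 (h x) = 0) ->
  exists k : {linear Q -> B}, forall x, d1 (k x) = h x.
Proof.
move=> Qproj ex h0.
have toker (U : lmodType A) (u : {linear U -> C}) : (forall x, d0 (u x) = 0) ->
    exists k : {linear U -> ker_type d0}, forall x, val (k x) = u x.
  move=> u0; have uK x : u x \in ker_mem d0 by apply/eqP.
  pose k x : ker_type d0 := KerType (uK x).
  have klin : linear k by move=> a x y; apply: val_inj; rewrite /= linearP.
  pose kM := GRing.isLinear.Build _ _ _ _ k klin.
  by pose kL : {linear U -> ker_type d0} := HB.pack k kM; exists kL.
have [e eE] := toker _ d1 (fun x => (ex (d1 x)).2 (ex_intro _ x erefl)).
have [h' h'E] := toker _ h h0.
have es : surjective e.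
  move=> y; have [x xE] := (ex (val y)).1 (eqP (valP y)).
  by exists x; apply: val_inj; rewrite eE.
have [k kE] := Qproj _ _ e h' es.
by exists k => x; rewrite -eE kE h'E.
Qed.

Section Independence.
Variables (R : topPzRingType) (M : lmodType R^c).

Lemma presentation_map (P P' : projPresentation M) :
  exists (a0 : {linear pres0 P -> pres0 P'}) (a1 : {linear pres1 P -> pres1 P'}),
    (forall x, pres_d0 P' (a0 x) = pres_d0 P x) /\
    (forall x, pres_d1 P' (a1 x) = a0 (pres_d1 P x)).
Proof.
have [a0 a0E] := @pres0_projective _ _ P _ _ (pres_d0 P') (pres_d0 P)
  (@pres_d0_surjective _ _ P').
have [x|a1 a1E] := @exact_lift _ _ _ _ _ (pres_d1 P') (pres_d0 P') (a0 \o pres_d1 P)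
  (@pres1_projective _ _ P) (@pres_exact _ _ P').
  by rewrite /= a0E; apply/(@pres_exact _ _ P); exists x.
by exists a0, a1.
Qed.

(** Composing the lifts of [f] with comparison maps over the identity of [M] in both directions
    gives lifts on [P'], and linear maps respect [mulmod]. *)
Lemma tau2_set_independent (P P' : projPresentation M) (J : set R) :
  tau2_set P J `<=` tau2_set P' J.
Proof.
move=> f [f0 [f1 [c0 c1 rf rf0 rf1]]].
have [a0 [a1 [a0E a1E]]] := presentation_map P P'.
have [b0 [b1 [b0E b1E]]] := presentation_map P' P.
exists (a0 \o (f0 : {linear _ -> _}) \o b0 : {linear _ -> _}).
exists (a1 \o (f1 : {linear _ -> _}) \o b1 : {linear _ -> _}).
split=> [x|x|//|_ [x _ <-]|_ [x _ <-]] /=.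
- by rewrite a0E c0 b0E.
- by rewrite a1E c1 b1E.
- by apply: mulmod_linear; apply: rf0; exists (b0 x).
- by apply: mulmod_linear; apply: rf1; exists (b1 x).
Qed.

End Independence.

Section FreePresentation.
Variables (R : topPzRingType) (M : lmodType R^c) (m n : nat).
Variables (d1 : {linear 'rV[R^c]_m -> 'rV[R^c]_n}) (d0 : {linear 'rV[R^c]_n -> M}).
Hypothesis d0_surj : surjective d0.
Hypothesis d01_exact : forall x, d0 x = 0 <-> exists y, d1 y = x.

Let P := ProjPresentation (@rV_projective R^c m) (@rV_projective R^c n)
  d0_surj d01_exact.
Local Notation V := ('rV[R^c]_(n + m) : lmodType R^c).

Lemma row_mx_endo (a : {linear V -> 'rV[R^c]_n}) (b : {linear V -> 'rV[R^c]_m}) :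
  exists c : endo V, forall v, c v = row_mx (a v) (b v).
Proof.
apply: endo_mk => s x y.
by rewrite !linearP scale_row_mx add_row_mx.
Qed.

(* Commuting with both of them means being a chain map [c0 (+) c1]. *)
Definition chain_constraints : set (endo V) := [set a : endo V |
  (forall v, a v = row_mx (d1 (rsubmx v)) 0) \/ (forall v, a v = row_mx (lsubmx v) 0)].

Local Notation T := (centralizer chain_constraints).

Lemma chain_constraint_d :
  exists2 a, chain_constraints a & forall v, a v = row_mx (d1 (rsubmx v)) 0.
Proof.
by have [a aE] := row_mx_endo (d1 \o rsubmx) \0; exists a => //; left.
Qed.

Lemma chain_constraint_p :
  exists2 a, chain_constraints a & forall v, a v = row_mx (lsubmx v) 0.
Proof.
by have [a aE] := row_mx_endo lsubmx \0; exists a => //; right.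
Qed.

Lemma chain_map_l (c : T) u : (val c : endo V) (row_mx u 0) =
  row_mx (lsubmx ((val c : endo V) (row_mx u 0))) 0.
Proof.
have [p Xp pE] := chain_constraint_p.
have /(congr1 (fun h : endo V => h (row_mx u 0))) := centralizerP c Xp.
by rewrite !endoME !pE row_mxKl => ->.
Qed.

Lemma chain_map_d (c : T) w : lsubmx ((val c : endo V) (row_mx (d1 w) 0)) =
  d1 (rsubmx ((val c : endo V) (row_mx 0 w))).
Proof.
have [p Xp pE] := chain_constraint_d.
have /(congr1 (fun h : endo V => lsubmx (h (row_mx 0 w)))) := centralizerP c Xp.
by rewrite !endoME !pE row_mxKr row_mxKl => ->.
Qed.

Lemma chain_map_mk (f0 : {linear 'rV[R^c]_n -> 'rV[R^c]_n})
    (f1 : {linear 'rV[R^c]_m -> 'rV[R^c]_m}) :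
  (forall x, d1 (f1 x) = f0 (d1 x)) ->
  exists c : T, forall v, (val c : endo V) v = row_mx (f0 (lsubmx v)) (f1 (rsubmx v)).
Proof.
move=> f01; have [c cE] := row_mx_endo (f0 \o lsubmx) (f1 \o rsubmx).
have [|c' c'E] := @centralizer_mk _ chain_constraints c; last first.
  by exists c' => v; rewrite c'E cE.
move=> a [aE|aE]; apply: linear_ext => v; rewrite -[LHS]/(a (c v)) -[RHS]/(c (a v)).
  by rewrite aE !cE aE /= row_mxKl !row_mxKr linear0 f01.
by rewrite aE !cE aE /= !row_mxKl row_mxKr linear0.
Qed.

Lemma chain_endo : exists phi : {rmorphism T -> endo M},
  forall c u, phi c (d0 u) = d0 (lsubmx ((val c : endo V) (row_mx u 0))).
Proof.
have [h hK] := choice d0_surj.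
pose F (c : T) u := d0 (lsubmx ((val c : endo V) (row_mx u 0))).
have rowB (u u' : 'rV[R^c]_n) : row_mx (u - u') 0 =
    row_mx u 0 - row_mx u' 0 :> 'rV[R^c]_(n + m).
  by rewrite opp_row_mx add_row_mx subrr.
(* Well-definedness: [c] preserves the range of [d1], which is the kernel of [d0]. *)
have FE c u u' : d0 u = d0 u' -> F c u = F c u'.
  move=> /eqP; rewrite -subr_eq0 -linearB => /eqP /d01_exact[w wE].
  have FB : F c (u - u') = F c u - F c u' by rewrite /F rowB endoB !linearB.
  apply/eqP; rewrite -subr_eq0 -FB /F -wE chain_map_d.
  by apply/eqP/d01_exact; eexists.
have Flin c : linear (fun x => F c (h x)).
  move=> a x y; have -> : F c (h (a *: x + y)) = F c (a *: h x + h y).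
    by apply: FE; rewrite linearP !hK.
  rewrite /F -linearP -linearP; congr (d0 (lsubmx _)).
  by rewrite -endoZ -endoDv scale_row_mx add_row_mx scaler0 addr0.
have /choice[psi psiE] c := endo_mk (Flin c).
have psiF c u : psi c (d0 u) = F c u by rewrite psiE; apply: FE; rewrite hK.
have [||phi phiE] := @rmorphism_mk T (endo M) psi.
- move=> c c'; apply: linear_ext => x; have [u <-] := d0_surj x.
  rewrite -[RHS]/(psi c (d0 u) - psi c' (d0 u)) !psiF /F -!linearB.
  by [].
- split=> [|c c']; apply: linear_ext => x; have [u <-] := d0_surj x.
    by rewrite psiF /F -[RHS]/(d0 u) row_mxKl.
  by rewrite -[RHS]/(psi c (psi c' (d0 u))) !psiF /F -chain_map_l.
by exists phi => c u; rewrite phiE psiF.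
Qed.

Variable phi : {rmorphism T -> endo M}.
Hypothesis phiE : forall c u, phi c (d0 u) = d0 (lsubmx ((val c : endo V) (row_mx u 0))).

Lemma chain_endo_surj : surjective phi.
Proof.
move=> e; have [f0 [f1 [c0 c1]]] := endo_lift P e.
have [c cE] := chain_map_mk c1; exists c; apply: linear_ext => x.
by have [u <-] := d0_surj x; rewrite phiE cE !row_mxKl c0.
Qed.

(** Entrywise, the range conditions on [f0] and [f1] amount to one condition on their sum; the
    condition on [f] follows by applying [d0]. *)
Lemma chain_endo_tau2 (J : set R) : two_sided_ideal J ->
  [set phi c | c in [set c : T | forall v, mulmod V J ((val c : endo V) v)]] =
    tau2_set P J.
Proof.
move=> iJ; apply/seteqP; split=> [_ [c Jc <-]|f [f0 [f1 [c0 c1 rf rf0 rf1]]]].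
  have [f0 f0E] : exists f0 : endo 'rV[R^c]_n, forall u,
      f0 u = lsubmx ((val c : endo V) (row_mx u 0)).
    apply: endo_mk => a x y; rewrite -linearP -endoZ -endoDv.
    by rewrite scale_row_mx add_row_mx scaler0 addr0.
  have [f1 f1E] : exists f1 : endo 'rV[R^c]_m, forall w,
      f1 w = rsubmx ((val c : endo V) (row_mx 0 w)).
    apply: endo_mk => a x y; rewrite -linearP -endoZ -endoDv.
    by rewrite scale_row_mx add_row_mx scaler0 addr0.
  have J0 u : mulmod 'rV[R^c]_n J (f0 u).
    by apply/mulmod_row => // i; rewrite f0E mxE; apply: ((mulmod_row iJ _).1 (Jc _)).
  exists f0, f1; split.
  - by move=> x; rewrite phiE f0E.
  - by move=> x; rewrite f0E f1E /= chain_map_d.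
  - move=> _ [x _ <-]; have [u <-] := d0_surj x; rewrite phiE -f0E.
    exact: mulmod_linear.
  - by move=> _ [x _ <-]; exact: J0.
  - move=> _ [x _ <-]; apply/mulmod_row => // i; rewrite f1E mxE.
    exact: ((mulmod_row iJ _).1 (Jc _)).
have [c cE] := chain_map_mk c1; exists c.
  move=> v /=; apply/mulmod_row => // i; rewrite cE mxE.
  case: splitP => j _; first by apply: ((mulmod_row iJ _).1 (rf0 _ _)); eexists.
  by apply: ((mulmod_row iJ _).1 (rf1 _ _)); eexists.
apply: linear_ext => x; have [u <-] := d0_surj x.
by rewrite phiE cE !row_mxKl c0.
Qed.

End FreePresentation.

Lemma endo_tau2_pro_semiprimary (R : topPzRingType) (M : lmodType R^c) :
  first_countable R -> strictly_pro_right_artinian R -> finitely_presented M ->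
  forall P : projPresentation M,
    pro_semiprimary (endo_tau2 P) /\ first_countable (endo_tau2 P).
Proof.
move=> Rfc Rart fpM P; have [J [aJ oJ cofJ]] := artinian_completion_exists Rfc Rart.
have [m [n [d1 [d0 [d0s ex]]]]] := fpM.
have [phi phiE] := chain_endo d0s ex.
have iJ := ac_ideal aJ.
set P' := ProjPresentation (@rV_projective R^c m) (@rV_projective R^c n) d0s ex.
have BE k : phi @` filt_endos (fun k => mulmod 'rV[R^c]_(n + m) (J k)) k =
    tau2_set P (J k).
  transitivity (tau2_set P' (J k)); first exact: chain_endo_tau2.
  by apply/seteqP; split; exact: tau2_set_independent.
apply: (centralizer_image_pro_semiprimary (row_filtration aJ (n + m)) (phi := phi)).
- exact: chain_endo_surj phiE.
- by move=> k; rewrite BE; exists (J k).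
- move=> _ [K [oK iK ->]]; have [|k kK] := cofJ K.
    by apply: open_nbhs_nbhs; split=> //; case: iK.
  by exists k; rewrite BE; exact: tau2_setS.
(* Separation of the free module would not suffice, as [phi] may have a kernel; that of [M] enters
   here. *)
- move=> f Bf; apply: linear_ext => x; apply: (filt_sep (fp_filtration aJ fpM)) => k.
  by have := Bf k; rewrite BE => -[f0 [f1 [_ _ rf _ _]]]; apply: rf; exists x.
Qed.

(** * Algebras over a commutative ring *)

(* A module over a commutative [S], regarded as a right module. *)
Definition converse_module (S : comPzRingType) (V : lmodType S) : Type := V.

Section ConverseModule.
Variables (S : comPzRingType) (V : lmodType S).
Local Notation W := (converse_module V).

HB.instance Definition _ := GRing.Zmodule.on W.

Let scale (s : S^c) (v : W) : W := (s : S) *: (v : V).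

Let scaleA a b v : scale a (scale b v) = scale (a * b) v.
Proof. by rewrite /scale scalerA mulrC. Qed.

Let scale1 : left_id 1 scale.
Proof. by move=> v; exact: scale1r. Qed.

Let scaleDr : right_distributive scale +%R.
Proof. by move=> a u v; exact: scalerDr. Qed.

Let scaleDl v : {morph scale^~ v : a b / a + b}.
Proof. by move=> a b; exact: scalerDl. Qed.

HB.instance Definition _ := GRing.Zmodule_isLmodule.Build S^c W
  scaleA scale1 scaleDr scaleDl.

Lemma converse_module_fp : finitely_presented V -> @finitely_presented S^c W.
Proof.
move=> [m [n [f [g [gs ex]]]]].
have rowZ k (a : S) (x : 'rV[S]_k) : ((a : S^c) *: (x : 'rV[S^c]_k)) = a *: x.
  by apply/rowP => i; rewrite !mxE [RHS]mulrC.
pose fc : 'rV[S^c]_m -> 'rV[S^c]_n := f.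
pose gc : 'rV[S^c]_n -> W := g.
have fl : linear fc by move=> a x y; rewrite /fc rowZ (linearP f) rowZ.
have gl : linear gc by move=> a x y; rewrite /gc rowZ (linearP g).
pose fM := GRing.isLinear.Build _ _ _ _ fc fl.
pose f' : {linear 'rV[S^c]_m -> 'rV[S^c]_n} := HB.pack fc fM.
pose gM := GRing.isLinear.Build _ _ _ _ gc gl.
pose g' : {linear 'rV[S^c]_n -> W} := HB.pack gc gM.
by exists m, n, f', g'; split.
Qed.

End ConverseModule.

(** The repackaged structure has the same fields, so both sides agree once [E] is destructed. *)
Lemma linear_topology_ring (E : pzRingType) (b : idealBase E) :
  (linear_topology b : pzRingType) = E.
Proof. by case: E b => E [? ? ? ? ? ? ? ? ?] b. Qed.

Lemma two_sided_ideal_image (T Q : pzRingType) (f : {rmorphism T -> Q}) (I : set T) :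
  surjective f -> two_sided_ideal I -> two_sided_ideal (f @` I).
Proof.
move=> fs [I0 IB Il Ir]; split.
- by exists 0; rewrite ?rmorph0.
- by move=> _ _ [x Ix <-] [y Iy <-]; exists (x - y); [exact: IB|rewrite rmorphB].
- by move=> a _ [x Ix <-]; have [b <-] := fs a; exists (b * x); [exact: Il|rewrite rmorphM].
- by move=> a _ [x Ix <-]; have [b <-] := fs a; exists (x * b); [exact: Ir|rewrite rmorphM].
Qed.

Lemma chain_idealBase (E : pzRingType) (B : nat -> set E) :
  (forall k, two_sided_ideal (B k)) -> (forall k, B k.+1 `<=` B k) ->
  exists b : idealBase E, ideal_base b = [set B k | k in setT].
Proof.
move=> iB dB; pose D := [set B k | k in setT].
have D0 : D !=set0 by exists (B 0%N), 0%N.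
have DD U W : D U -> D W -> exists2 Z, D Z & Z `<=` U `&` W.
  move=> [k _ <-] [l _ <-]; exists (B (maxn k l)); first by exists (maxn k l).
  by rewrite subsetI; split; apply: (decreasing_le dB); rewrite ?leq_maxl ?leq_maxr.
have DI U : D U -> two_sided_ideal U by move=> [k _ <-].
by exists (IdealBase D0 DD DI).
Qed.

Section Algebra.
Variables (S : comPzRingType) (R : pzRingType) (iota : {rmorphism S -> R}).
Hypothesis iota_central : central_morphism iota.
Local Notation M := (converse_module (algebra_module iota) : lmodType S^c).

Definition right_multiplications : set (endo M) :=
  [set h : endo M | exists r : R, forall x : R, (h x : R) = x * r].

Local Notation T := (centralizer right_multiplications).

Lemma right_multiplication_mk (r : R) : exists2 h : endo M,
  right_multiplications h & forall x : R, (h x : R) = x * r.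
Proof.
pose mulr_r : M -> M := fun x => (x : R) * r.
have hl : linear mulr_r.
  rewrite /mulr_r => a x y; rewrite mulrDl; congr (_ + _).
  by rewrite -[a *: x]/(iota a * (x : R)) -mulrA.
by have [h hE] := endo_mk hl; exists h; [exists r|].
Qed.

(** A map commuting with all right multiplications is left multiplication by its value at 1, and
    centrality of [iota] makes left multiplications linear over [S]. *)
Lemma algebra_endo : exists2 phi : {rmorphism T -> R}, surjective phi &
  forall f, phi f = (val f : endo M) (1 : R).
Proof.
have valM (f : T) (r : R) : ((val f : endo M) r : R) =
    ((val f : endo M) (1 : R) : R) * r.
  have [h Xh hE] := right_multiplication_mk r.
  have /(congr1 (fun g : endo M => g (1 : R))) := centralizerP f Xh.
  by rewrite !endoME -[in LHS]/(h _) hE hE mul1r => <-.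
have [||phi phiE] := @rmorphism_mk T R (fun f => (val f : endo M) (1 : R)).
- by move=> f g.
- by split=> [//|f g]; rewrite centralizerME valM.
exists phi => // r.
pose mul_r : M -> M := fun x => r * (x : R).
have hl : linear mul_r.
  rewrite /mul_r => a x y; rewrite mulrDr; congr (_ + _).
  by rewrite -[a *: x]/(iota a * (x : R)) mulrA -iota_central -mulrA.
have [h hE] := endo_mk hl.
have [|f fE] := @centralizer_mk _ right_multiplications h.
  move=> a [s aE]; apply: linear_ext => x.
  rewrite -[LHS]/(a (h x)) -[RHS]/(h (a x)) !hE.
  by rewrite [LHS]aE /mul_r [a x]aE mulrA.
by exists f; rewrite phiE fE hE /mul_r mulr1.
Qed.

Variable J : nat -> set S.
Hypothesis aJ : artinian_completion J.
Hypothesis fpR : finitely_presented (algebra_module iota).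

Let fpM : finitely_presented M := converse_module_fp fpR.

(** The topology comes from the left multiplications that send [R] into [R J k]. *)
Lemma algebra_pro_semiprimary :
  exists T : topPzRingType, (T : pzRingType) = R /\ pro_semiprimary T.
Proof.
have cM := fp_filtration aJ fpM.
have [phi phis phiE] := algebra_endo.
pose B k := phi @` filt_endos (fun k => mulmod M (J k)) k.
have [k|k _ [f Ff <-]|b bE] := @chain_idealBase R B.
- by apply: two_sided_ideal_image => //; exact: filt_endos_ideal.
- by exists f => // v; exact: (filt_dec cM (Ff v)).
exists (linear_topology b); split; first exact: linear_topology_ring.
have [|||//] := centralizer_image_pro_semiprimary cM phis (b := b).
- by move=> k; rewrite bE; exists k.
- by move=> U; rewrite bE => -[k _ <-]; exists k.
- move=> x Bx; apply: (filt_sep cM) => k; have [f Ff <-] := Bx k.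
  by rewrite phiE; exact: Ff.
Qed.

Lemma algebra_semiperfect : semiperfect S -> semiperfect R.
Proof.
move=> [[_ Sart] _]; have [phi phis _] := algebra_endo.
apply: cover_semiperfect; apply: (idempotent_cover_image phis).
exact: (centralizer_cover aJ fpM).
Qed.

End Algebra.

Theorem corollary9p12 :
  (forall (R : topPzRingType) (M : lmodType R^c),
     first_countable R -> strictly_pro_right_artinian R ->
     finitely_presented M ->
     [/\ forall P : projPresentation M,
           pro_semiprimary (endo_tau2 P) /\ first_countable (endo_tau2 P),
         right_noetherian R -> semiperfect R &
         semiperfect R -> semiperfect (endo M)])
  /\
  (forall (S : topComPzRingType) (R : pzRingType) (iota : {rmorphism S -> R}),
     first_countable S -> strictly_pro_right_artinian S ->
     central_morphism iota -> finitely_presented (algebra_module iota) ->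
     [/\ exists T : topPzRingType, (T : pzRingType) = R /\ pro_semiprimary T,
         right_noetherian S -> semiperfect S &
         semiperfect S -> semiperfect R]).
Proof.
split=> [R M Rfc Rart fpM|S R iota Sfc Sart central fpR].
  have [J [aJ _ _]] := artinian_completion_exists Rfc Rart.
  split=> [|Rnoeth|[[_ Qart] _]]; first exact: endo_tau2_pro_semiprimary.
    exact/cover_semiperfect/(noetherian_cover aJ).
  apply: cover_semiperfect.
  (* [End M] is its own centralizer of the empty set, so [centralizer_cover] applies to it. *)
  pose incl : {rmorphism centralizer (@set0 (endo M)) -> endo M} := val.
  apply: (idempotent_cover_image (f := incl)).
    by move=> f; apply: centralizer_mk => a [].
  exact: (centralizer_cover aJ fpM).
have [J [aJ _ _]] := artinian_completion_exists Sfc Sart.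
split=> [|Snoeth|].
- exact: (algebra_pro_semiprimary central aJ fpR).
- exact/cover_semiperfect/(noetherian_cover aJ).
- exact: (algebra_semiperfect central aJ fpR).
Qed.
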